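(* Let $G$ and $H$ be two finite abelian groups and let $K$ be a field of characteristic zero such that the partial group algebras $K_{\mathrm{par}}(G)$ and $K_{\mathrm{par}}(H)$ are isomorphic as $K$-algebras. Then $G$ and $H$ are isomorphic groups.
   Context: For a finite group $G$ with identity $e$ and a field $K$, the partial group algebra $K_{\mathrm{par}}(G)$ is the universal associative $K$-algebra with unit $1$ generated by the set of symbols $\{[g] : g\in G\}$ subject to the relations (1) $[e]=1$; (2) $[s^{-1}][s][t]=[s^{-1}][st]$; (3) $[s][t][t^{-1}]=[st][t^{-1}]$, for all $s,t\in G$. *)

(* Defs.v *)
From HB Require Import structures.
From mathcomp Require Import all_boot all_fingroup all_algebra.
From mathcomp Require Import generic_quotient boolp.

Set Implicit Arguments.
Unset Strict Implicit.
Unset Printing Implicit Defensive.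

Import GRing.Theory.
Local Open Scope ring_scope.
Local Open Scope quotient_scope.

(* K_par(G) by generators and relations: formal K-algebra expressions in the *)
(* symbols [g] (here PGen g), modulo the least congruence containing the      *)
(* axioms of associative unital K-algebras and                                *)
(*   [e] = 1,   [s^-1][s][t] = [s^-1][st],   [s][t][t^-1] = [st][t^-1].       *)
(* That it is the universal algebra with these relations is par_universal.    *)

Section PartialGroupAlgebra.

Variables (K : fieldType) (gT : finGroupType).

Inductive par_term : Type :=
  | PGen of gT
  | PZero
  | POne
  | POpp of par_term
  | PAdd of par_term & par_term
  | PMul of par_term & par_term
  | PScale of K & par_term.

HB.instance Definition _ := gen_eqMixin par_term.
HB.instance Definition _ := gen_choiceMixin par_term.

Inductive par_cong : par_term -> par_term -> Prop :=
  | pc_gen1 : par_cong (PGen 1%g) POne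
  | pc_genVM s t :
      par_cong (PMul (PMul (PGen s^-1%g) (PGen s)) (PGen t))
               (PMul (PGen s^-1%g) (PGen (s * t)%g))
  | pc_genMV s t :
      par_cong (PMul (PMul (PGen s) (PGen t)) (PGen t^-1%g))
               (PMul (PGen (s * t)%g) (PGen t^-1%g))
  | pc_addA x y z : par_cong (PAdd x (PAdd y z)) (PAdd (PAdd x y) z)
  | pc_addC x y : par_cong (PAdd x y) (PAdd y x)
  | pc_add0 x : par_cong (PAdd PZero x) x
  | pc_addN x : par_cong (PAdd (POpp x) x) PZero
  | pc_mulA x y z : par_cong (PMul x (PMul y z)) (PMul (PMul x y) z)
  | pc_mul1l x : par_cong (PMul POne x) x
  | pc_mul1r x : par_cong (PMul x POne) x
  | pc_mulDl x y z :
      par_cong (PMul (PAdd x y) z) (PAdd (PMul x z) (PMul y z))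
  | pc_mulDr x y z :
      par_cong (PMul x (PAdd y z)) (PAdd (PMul x y) (PMul x z))
  | pc_scaleA a b x : par_cong (PScale a (PScale b x)) (PScale (a * b) x)
  | pc_scale1 x : par_cong (PScale 1 x) x
  | pc_scaleDr a x y :
      par_cong (PScale a (PAdd x y)) (PAdd (PScale a x) (PScale a y))
  | pc_scaleDl a b x :
      par_cong (PScale (a + b) x) (PAdd (PScale a x) (PScale b x))
  | pc_scaleAl a x y : par_cong (PScale a (PMul x y)) (PMul (PScale a x) y)
  | pc_scaleAr a x y : par_cong (PScale a (PMul x y)) (PMul x (PScale a y))
  | pc_refl x : par_cong x x
  | pc_sym x y : par_cong x y -> par_cong y x
  | pc_trans x y z : par_cong x y -> par_cong y z -> par_cong x z
  | pc_opp x x' : par_cong x x' -> par_cong (POpp x) (POpp x')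
  | pc_add x x' y y' :
      par_cong x x' -> par_cong y y' -> par_cong (PAdd x y) (PAdd x' y')
  | pc_mul x x' y y' :
      par_cong x x' -> par_cong y y' -> par_cong (PMul x y) (PMul x' y')
  | pc_scale a x x' : par_cong x x' -> par_cong (PScale a x) (PScale a x').

Definition par_congb : rel par_term := fun x y => `[< par_cong x y >].

Fact par_congb_refl : reflexive par_congb.
Proof. by move=> x; apply/asboolP; exact: pc_refl. Qed.

Fact par_congb_sym : symmetric par_congb.
Proof. by move=> x y; apply/asboolP/asboolP; exact: pc_sym. Qed.

Fact par_congb_trans : transitive par_congb.
Proof.
by move=> y x z /asboolP xy /asboolP yz; apply/asboolP; exact: pc_trans yz.
Qed.

Canonical par_equiv :=
  EquivRel par_congb par_congb_refl par_congb_sym par_congb_trans.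

Definition par_algebra : Type := {eq_quot par_equiv}.

HB.instance Definition _ := Choice.on par_algebra.
HB.instance Definition _ := Quotient.on par_algebra.

Lemma par_piP x y : \pi_par_algebra x = \pi_par_algebra y <-> par_cong x y.
Proof.
split=> [/eqmodP/asboolP //|xy].
by apply/eqmodP/asboolP.
Qed.

Lemma par_reprP x : par_cong (repr (\pi_par_algebra x)) x.
Proof. by apply/par_piP; rewrite reprK. Qed.

Implicit Types u v w : par_algebra.

Definition par_gen (g : gT) : par_algebra := \pi_par_algebra (PGen g).
Definition par_zero : par_algebra := \pi_par_algebra PZero.
Definition par_one : par_algebra := \pi_par_algebra POne.
Definition par_opp u : par_algebra := \pi_par_algebra (POpp (repr u)).
Definition par_add u v : par_algebra := \pi_par_algebra (PAdd (repr u) (repr v)).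
Definition par_mul u v : par_algebra := \pi_par_algebra (PMul (repr u) (repr v)).
Definition par_scale (a : K) u : par_algebra := \pi_par_algebra (PScale a (repr u)).

Lemma par_piN x : \pi_par_algebra (POpp x) = par_opp (\pi_par_algebra x).
Proof. by apply/par_piP/pc_opp/pc_sym/par_reprP. Qed.

Lemma par_piD x y : \pi_par_algebra (PAdd x y) = par_add (\pi_par_algebra x) (\pi_par_algebra y).
Proof. by apply/par_piP/pc_add; exact/pc_sym/par_reprP. Qed.

Lemma par_piM x y : \pi_par_algebra (PMul x y) = par_mul (\pi_par_algebra x) (\pi_par_algebra y).
Proof. by apply/par_piP/pc_mul; exact/pc_sym/par_reprP. Qed.

Lemma par_piZ a x : \pi_par_algebra (PScale a x) = par_scale a (\pi_par_algebra x).
Proof. by apply/par_piP/pc_scale/pc_sym/par_reprP. Qed.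

Let par_pi := (par_piN, par_piD, par_piM, par_piZ).

Fact par_addA : associative par_add.
Proof.
elim/quotW=> x; elim/quotW=> y; elim/quotW=> z.
by have /par_piP := pc_addA x y z; rewrite !par_pi.
Qed.

Fact par_addC : commutative par_add.
Proof.
elim/quotW=> x; elim/quotW=> y.
by have /par_piP := pc_addC x y; rewrite !par_pi.
Qed.

Fact par_add0 : left_id par_zero par_add.
Proof. by elim/quotW=> x; have /par_piP := pc_add0 x; rewrite !par_pi. Qed.

Fact par_addN : left_inverse par_zero par_opp par_add.
Proof. by elim/quotW=> x; have /par_piP := pc_addN x; rewrite !par_pi. Qed.

HB.instance Definition _ :=
  GRing.isZmodule.Build par_algebra par_addA par_addC par_add0 par_addN.

Fact par_mulA : associative par_mul.
Proof.
elim/quotW=> x; elim/quotW=> y; elim/quotW=> z.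
by have /par_piP := pc_mulA x y z; rewrite !par_pi.
Qed.

Fact par_mul1l : left_id par_one par_mul.
Proof. by elim/quotW=> x; have /par_piP := pc_mul1l x; rewrite !par_pi. Qed.

Fact par_mul1r : right_id par_one par_mul.
Proof. by elim/quotW=> x; have /par_piP := pc_mul1r x; rewrite !par_pi. Qed.

Fact par_mulDl : left_distributive par_mul par_add.
Proof.
elim/quotW=> x; elim/quotW=> y; elim/quotW=> z.
by have /par_piP := pc_mulDl x y z; rewrite !par_pi.
Qed.

Fact par_mulDr : right_distributive par_mul par_add.
Proof.
elim/quotW=> x; elim/quotW=> y; elim/quotW=> z.
by have /par_piP := pc_mulDr x y z; rewrite !par_pi.
Qed.

Section Evaluation.

Variables (A : algType K) (f : gT -> A).

Definition par_relations : Prop :=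
  [/\ f 1%g = 1,
      forall s t, f s^-1%g * f s * f t = f s^-1%g * f (s * t)%g
    & forall s t, f s * f t * f t^-1%g = f (s * t)%g * f t^-1%g].

Fixpoint par_eval (x : par_term) : A :=
  match x with
  | PGen g => f g
  | PZero => 0
  | POne => 1
  | POpp x => - par_eval x
  | PAdd x y => par_eval x + par_eval y
  | PMul x y => par_eval x * par_eval y
  | PScale a x => a *: par_eval x
  end.

Lemma par_eval_cong x y :
  par_relations -> par_cong x y -> par_eval x = par_eval y.
Proof.
case=> f1 fV fM; elim => //=.
- by move=> *; rewrite addrA.
- by move=> *; rewrite addrC.
- by move=> *; rewrite add0r.
- by move=> *; rewrite addNr.
- by move=> *; rewrite mulrA.
- by move=> *; rewrite mul1r.
- by move=> *; rewrite mulr1.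
- by move=> *; rewrite mulrDl.
- by move=> *; rewrite mulrDr.
- by move=> *; rewrite scalerA.
- by move=> *; rewrite scale1r.
- by move=> *; rewrite scalerDr.
- by move=> *; rewrite scalerDl.
- by move=> *; rewrite scalerAl.
- by move=> *; rewrite scalerAr.
- by move=> ? ? ? _ -> _ ->.
- by move=> ? ? _ ->.
- by move=> ? ? ? ? _ -> _ ->.
- by move=> ? ? ? ? _ -> _ ->.
- by move=> ? ? ? _ ->.
Qed.

End Evaluation.

(* Nontriviality: K itself, with every [g] sent to 1, satisfies the relations. *)
Fact par_oner_neq0 : par_one != par_zero.
Proof.
apply/eqP=> /par_piP/(@par_eval_cong K^o (fun=> 1)) h.
suff /h/eqP : par_relations (fun=> 1 : K^o) by rewrite /= oner_eq0.
by split=> *; rewrite ?mulr1.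
Qed.

HB.instance Definition _ :=
  GRing.Zmodule_isNzRing.Build par_algebra
    par_mulA par_mul1l par_mul1r par_mulDl par_mulDr par_oner_neq0.

Fact par_scaleA a b u : par_scale a (par_scale b u) = par_scale (a * b) u.
Proof.
by elim/quotW: u => x; have /par_piP := pc_scaleA a b x; rewrite !par_pi.
Qed.

Fact par_scale1 : left_id 1 par_scale.
Proof. by elim/quotW=> x; have /par_piP := pc_scale1 x; rewrite !par_pi. Qed.

Fact par_scaleDr : right_distributive par_scale +%R.
Proof.
move=> a; elim/quotW=> x; elim/quotW=> y; rewrite /+%R /=.
by have /par_piP := pc_scaleDr a x y; rewrite !par_pi.
Qed.

Fact par_scaleDl u : {morph par_scale^~ u : a b / a + b}.
Proof.
move=> a b; elim/quotW: u => x; rewrite [RHS]/+%R /=.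
by have /par_piP := pc_scaleDl a b x; rewrite !par_pi.
Qed.

HB.instance Definition _ :=
  GRing.Zmodule_isLmodule.Build K par_algebra
    par_scaleA par_scale1 par_scaleDr par_scaleDl.

Fact par_scaleAl (a : K) u v : a *: (u * v) = (a *: u) * v.
Proof.
rewrite /*:%R /*%R /=; elim/quotW: u => x; elim/quotW: v => y.
by have /par_piP := pc_scaleAl a x y; rewrite !par_pi.
Qed.

HB.instance Definition _ :=
  GRing.Lmodule_isLalgebra.Build K par_algebra par_scaleAl.

Fact par_scaleAr (a : K) u v : a *: (u * v) = u * (a *: v).
Proof.
rewrite /*:%R /*%R /=; elim/quotW: u => x; elim/quotW: v => y.
by have /par_piP := pc_scaleAr a x y; rewrite !par_pi.
Qed.

HB.instance Definition _ :=
  GRing.Lalgebra_isAlgebra.Build K par_algebra par_scaleAr.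

Lemma par_gen_relations : par_relations par_gen.
Proof.
split=> [|s t|s t]; rewrite /par_gen; first exact/par_piP/pc_gen1.
  by have /par_piP := pc_genVM s t; rewrite !par_pi.
by have /par_piP := pc_genMV s t; rewrite !par_pi.
Qed.

Section Universal.

Variables (A : algType K) (f : gT -> A) (fP : par_relations f).

Definition par_lift u : A := par_eval f (repr u).

Lemma par_lift_pi x : par_lift (\pi_par_algebra x) = par_eval f x.
Proof. exact/par_eval_cong/par_reprP. Qed.

Fact par_lift_is_linear : linear par_lift.
Proof.
move=> a; elim/quotW=> x; elim/quotW=> y.
have -> : a *: \pi_par_algebra x + \pi_par_algebra y =
  \pi_par_algebra (PAdd (PScale a x) y) by rewrite !par_pi.
by rewrite !par_lift_pi.
Qed.

Fact par_lift_is_monoid_morphism : monoid_morphism par_lift.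
Proof.
split; first exact: par_lift_pi.
elim/quotW=> x; elim/quotW=> y.
have -> : \pi_par_algebra x * \pi_par_algebra y = \pi_par_algebra (PMul x y).
  by rewrite par_piM.
by rewrite !par_lift_pi.
Qed.

Lemma par_universal :
  exists f' : {lrmorphism par_algebra -> A},
    (forall g, f' (par_gen g) = f g) /\
    (forall h : {lrmorphism par_algebra -> A},
       (forall g, h (par_gen g) = f g) -> h =1 f').
Proof.
pose lL := GRing.isLinear.Build K par_algebra A _ par_lift par_lift_is_linear.
pose lM := GRing.isMonoidMorphism.Build par_algebra A par_lift
  par_lift_is_monoid_morphism.
pose F : {lrmorphism par_algebra -> A} := HB.pack par_lift lL lM.
exists F; split=> [g|h hg]; first exact: par_lift_pi.
elim/quotW=> x; rewrite [RHS]par_lift_pi.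
elim: x => [g|||x IHx|x IHx y IHy|x IHx y IHy|a x IHx] /=.
- exact: hg.
- exact: (raddf0 h).
- exact: (rmorph1 h).
- by rewrite par_piN -IHx; exact: (raddfN h).
- by rewrite par_piD -IHx -IHy; exact: (raddfD h).
- by rewrite par_piM -IHx -IHy; exact: (rmorphM h).
- by rewrite par_piZ -IHx; exact: (linearZ_LR h).
Qed.

End Universal.

End PartialGroupAlgebra.

Definition alg_isomorphic (K : fieldType) (A B : algType K) : Prop :=
  exists f : {lrmorphism A -> B}, bijective f.

(* Main.v *)
Require Import Defs.
From HB Require Import structures.
From mathcomp Require Import all_boot all_fingroup all_algebra all_solvable.
From mathcomp Require Import zify.

(** K_par(G) is the algebra of a finite groupoid.  Its objects are the subsets A
    of G that contain 1, and for each k in A there is an arrow from k^-1 A to A,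
    represented by P_A [k], where P_A is the product of the commuting idempotents
    [g][g^-1] for g in A and 1 - [g][g^-1] for g outside A.  These arrows form a
    basis.  They span because the generators permute the P_A
    ([par_proj_span]); they are independent because every A carries a
    representation by restricted translations ([par_basis_free]).

    The isotropy group at A is the translation stabiliser [stab A], and the
    component of A has m = |A| / |stab A| objects.  So, for abelian G, the
    algebra is a product of matrix algebras of sizes m over commutative group
    algebras.  The sizes are recovered without splitting these group algebras.
    The tensor t = sum (1 / |A|) a (x) a^-1 over all arrows a, where A is the
    target of a, is a symmetric separability idempotent, and any algebra has at
    most one ([sym_sep_idem_uniq]).  Hence the element sum x x' y y', where
    x (x) y and x' (x) y' run through two copies of t, is preserved by
    isomorphisms.  When G is abelian it equals
    sum_A (|stab A| / |A|)^2 P_A ([par_casimirE]).  In characteristic zero its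
    eigenspace for 1 / m^2 has as a basis the arrows whose target A satisfies
    |A| = m |stab A|.  Thus the algebra determines, for every m, the number
    D_m of these arrows ([weight_leq]), which is [pointed_sets_weight].

    It remains to recover an abelian group G from its D_m.  Their sum gives
    n = |G| ([eq_card_pointed_sets_weight]).  If m is prime to n, a set A with
    |A| = m |U| that is stable under a subgroup U has stabiliser exactly U, so
    D_m = m sum_U |U| C(n / |U| - 1, m - 1) over the subgroups U of G.  If k is
    a power of p and k p divides n, then m = n / k - 1 is prime to n, and this
    formula determines the number of subgroups of order k once the numbers of
    subgroups of smaller order are known ([eq_nsubgroups_pfactor]).  The
    noncyclic subgroups of order k lie in the (k / p)-torsion, so the number of
    cyclic ones, hence the number of elements of order k, is determined too
    ([nsubgroups_pfactor]).  By induction on prime powers G and H have equally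
    many elements killed by p^i, for all p and i, and this determines the
    invariant factors ([isog_card_Ldiv]). *)

Set Implicit Arguments.
Unset Strict Implicit.
Unset Printing Implicit Defensive.

(** * Abelian groups and their torsion counts *)

Section Abelian.
Local Open Scope group_scope.

Lemma logn_prod_gcd_pfactor p j (s : seq nat) :
    prime p -> all (leq 1) s ->
  logn p (\prod_(x <- s) gcdn (p ^ j) x) = (\sum_(x <- s) minn j (logn p x))%N.
Proof.
move=> pp; elim: s => [|x s IHs] /=; first by rewrite !big_nil logn1.
case/andP=> x0 s0; rewrite !big_cons -IHs // lognM ?gcdn_gt0 ?x0 ?orbT //.
  by rewrite logn_gcd ?pfactorK // expn_gt0 prime_gt0.
rewrite big_seq; apply: (big_ind (fun m => 0 < m)%N) => // [m n|i /(allP s0) i0].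
  by rewrite muln_gt0 => -> ->.
by rewrite gcdn_gt0 i0 orbT.
Qed.

(** Read with v = logn p, this turns the numbers of p^j-torsion elements into
    the numbers of cyclic factors of order divisible by p^(j+1). *)
Lemma sum_minS (T : Type) (v : T -> nat) j (s : seq T) :
  (\sum_(x <- s) minn j.+1 (v x) =
   \sum_(x <- s) minn j (v x) + count (fun x => j < v x) s)%N.
Proof.
elim: s => [|x s IHs]; first by rewrite !big_nil.
rewrite !big_cons /= IHs addnACA; congr (_ + _)%N.
by case: (ltnP j (v x)) => /=; lia.
Qed.

(** In a divisibility chain the first entry has the largest p-adic valuation
    for every p, so it is the product over p of p to the least j whose count
    vanishes; removing it lowers the counts of both chains equally. *)
Lemma dvdn_chain_inj (s t : seq nat) :
    sorted [rel m n | n %| m] s -> sorted [rel m n | n %| m] t ->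
    all [pred m | 1 < m]%N s -> all [pred m | 1 < m]%N t ->
    (forall p j, prime p ->
       count (fun x => j < logn p x)%N s = count (fun x => j < logn p x)%N t) ->
  s = t.
Proof.
have dtr : transitive [rel m n | n %| m] by move=> b a c /= ab bc; apply: dvdn_trans ab.
have head_has x (s1 : seq nat) p j : path [rel m n | n %| m] x s1 -> (1 < x)%N ->
    (j < logn p x)%N = (0 < count (fun y => j < logn p y)%N (x :: s1))%N.
  move=> /(order_path_min dtr)/allP xs x1; rewrite -has_count /=.
  case: (ltnP j (logn p x)) => //= jx; apply/esym/negbTE/hasPn => y /xs /= yx.
  by rewrite -leqNgt (leq_trans _ jx) // dvdn_leq_log // ltnW.
have nil_nil x (s1 : seq nat) : (1 < x)%N ->
    ~ (forall p j, prime p -> 0 = count (fun y => j < logn p y)%N (x :: s1)).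
  move=> x1 /(_ (pdiv x) 0 (pdiv_prime x1)) /=.
  by rewrite logn_gt0 pi_pdiv x1.
elim: s t => [|x s IHs] [|y t] //=.
- by move=> _ _ _ /andP[y1 _] /(nil_nil _ _ y1).
- by move=> _ _ /andP[x1 _] _ cnt; case: (nil_nil x s x1) => p j pp; rewrite /= cnt.
move=> xs yt /andP[x1 s1] /andP[y1 t1] cnt.
have xy : x = y.
  apply: eqn_from_log; try exact: ltnW.
  move=> p; have [pp|/negbTE np] := boolP (prime p); last first.
    by rewrite /= (lognE p x) (lognE p y) np.
  have lt_eq j : (j < logn p x)%N = (j < logn p y)%N.
    by rewrite (head_has x s) // (head_has y t) //= cnt.
  by have := lt_eq (logn p x); have := lt_eq (logn p y); rewrite /= !ltnn; lia.
rewrite -xy in yt cnt *; congr (_ :: _); apply: IHs => //; try exact: path_sorted xs.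
  exact: path_sorted yt.
by move=> p j pp; apply/eqP; rewrite -(eqn_add2l (j < logn p x)%N) cnt.
Qed.

Lemma Ldiv_cycle (gT : finGroupType) (x : gT) d :
  'Ldiv_d(<[x]>) = <[x ^+ (#[x] %/ gcdn #[x] d)]>.
Proof.
set o := #[x]; set g := gcdn o d.
have o0 : (0 < o)%N by exact: order_gt0.
have g0 : (0 < g)%N by rewrite gcdn_gt0 o0.
have oE : o = (o %/ g * g)%N by rewrite divnK // dvdn_gcdl.
have dE : d = (d %/ g * g)%N by rewrite divnK // dvdn_gcdr.
have cop : coprime (o %/ g) (d %/ g).
  by rewrite /coprime -(eqn_pmul2r g0) muln_gcdl -oE -dE mul1n.
apply/setP=> y; apply/LdivP/idP=> [[/cycleP[i ->]]|].
  rewrite -expgM => /eqP; rewrite -order_dvdn => dv.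
  have : (o %/ g * g %| i * (d %/ g) * g)%N by rewrite -oE -mulnA -dE.
  rewrite dvdn_pmul2r // Gauss_dvdl // => /dvdnP[c ->].
  by rewrite mulnC expgM mem_cycle.
case/cycleP=> i ->; rewrite groupX ?mem_cycle //; split=> //.
apply/eqP; rewrite -!expgM -order_dvdn -/o.
by rewrite {1}oE dE !mulnA dvdn_pmul2r // -mulnA dvdn_mulr.
Qed.

Lemma card_Ldiv_cycle (gT : finGroupType) (x : gT) d :
  #|'Ldiv_d(<[x]>)| = gcdn d #[x].
Proof.
rewrite Ldiv_cycle -orderE gcdnC.
have gx : gcdn d #[x] %| #[x] by apply: dvdn_gcdr.
have : (0 < gcdn d #[x])%N by rewrite gcdn_gt0 order_gt0 orbT.
move: (gcdn d #[x]) gx => g /dvdnP[c oE] g0.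
have c0 : (0 < c)%N by have := order_gt0 x; rewrite oE muln_gt0 => /andP[].
by rewrite oE mulnK // orderXdiv oE ?dvdn_mulr // mulKn.
Qed.

Lemma card_Ldiv_dprod (gT : finGroupType) (A B G : {group gT}) d :
  A \x B = G -> #|'Ldiv_d(G)| = (#|'Ldiv_d(A)| * #|'Ldiv_d(B)|)%N.
Proof.
case/dprodP=> _ defG cAB tiAB.
have TI : {in A & B, forall x y, x * y = 1 -> x = 1 /\ y = 1}.
  move=> x y Ax By xy1; have xE : x = y^-1 by apply/(mulIg y); rewrite xy1 mulVg.
  have : x \in A :&: B by rewrite inE Ax xE groupV.
  by rewrite tiAB => /set1P x1; move: xy1; rewrite x1 mul1g.
rewrite -cardsX.
have inj : {in setX 'Ldiv_d(A) 'Ldiv_d(B) &, injective (fun u : gT * gT => u.1 * u.2)}.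
  move=> [x y] [x' y'] /setXP[/= /LdivP[Ax _] /LdivP[By _]].
  case/setXP=> /= /LdivP[Ax' _] /LdivP[By' _] /= E.
  have xyE : (x'^-1 * x) * (y * y'^-1) = 1.
    by rewrite mulgA -(mulgA x'^-1) E mulgA mulVg mul1g mulgV.
  have [||/eqP x1 /eqP y1] := TI _ _ _ _ xyE; rewrite ?groupM ?groupV //.
  by move: x1 y1; rewrite -eq_mulVg1 -eq_mulgV1 => /eqP-> /eqP->.
rewrite -(card_in_imset inj); apply: eq_card => z.
apply/LdivP/imsetP => [[Gz zd]|[[x y] /setXP[/= /LdivP[Ax xd] /LdivP[By yd]] ->]].
  move: Gz; rewrite -defG => /mulsgP[x y Ax By zE].
  have cxy : commute x y by apply/commute_sym/(centsP cAB).
  have [xd yd] : x ^+ d = 1 /\ y ^+ d = 1.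
    by apply: TI; rewrite ?groupX // -expgMn // -zE.
  by exists (x, y) => //; apply/setXP; split; apply/LdivP.
have cxy : commute x y by apply/commute_sym/(centsP cAB).
by rewrite -defG mem_mulg // expgMn // xd yd mulg1.
Qed.

(** Torsion counts are multiplicative over direct factors, and a cyclic group
    of order x has gcd(d, x) elements killed by d. *)
Lemma card_Ldiv_abelian (gT : finGroupType) (G : {group gT}) d :
  abelian G -> #|'Ldiv_d(G)| = (\prod_(x <- abelian_type G) gcdn d x)%N.
Proof.
move=> cGG; have [b defG <-] := abelian_structure cGG.
elim: b G {cGG} defG => [|x b IHb] G.
  rewrite !big_nil => <-.
  by rewrite -cycle1 card_Ldiv_cycle order1 gcdn1.
rewrite big_cons => defG; have /dprodP[[_ H _ defH] _ _ _] := defG.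
rewrite defH in defG; rewrite (card_Ldiv_dprod d defG) card_Ldiv_cycle.
by rewrite (IHb H) // map_cons big_cons.
Qed.

(** The invariant factors of an abelian group form a divisibility chain, whose
    p-adic valuations can be read off from the p-power torsion counts. *)
Lemma isog_card_Ldiv (aT rT : finGroupType) (G : {group aT}) (H : {group rT}) :
    abelian G -> abelian H ->
    (forall p j, prime p -> #|'Ldiv_(p ^ j)(G)| = #|'Ldiv_(p ^ j)(H)|) ->
  G \isog H.
Proof.
move=> cGG cHH eqL; rewrite eq_abelian_type_isog //; apply/eqP.
apply: dvdn_chain_inj; rewrite ?abelian_type_dvdn_sorted ?abelian_type_gt1 //.
have pos (gT : finGroupType) (A : {set gT}) : all (leq 1) (abelian_type A).
  by apply: sub_all (abelian_type_gt1 A) => x /= /ltnW.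
have sumE (gT : finGroupType) (A : {group gT}) p j : prime p -> abelian A ->
    (\sum_(x <- abelian_type A) minn j (logn p x))%N = logn p #|'Ldiv_(p ^ j)(A)|.
  by move=> pp cAA; rewrite card_Ldiv_abelian // logn_prod_gcd_pfactor.
move=> p j pp; apply/eqP.
rewrite -(eqn_add2l (\sum_(x <- abelian_type G) minn j (logn p x))%N) -sum_minS.
by rewrite [X in X + _]sumE // eqL // -(sumE _ H) // -sum_minS !sumE // eqL.
Qed.

End Abelian.

(** * Counting subgroups of prime power order *)

Section SubgroupCount.
Local Open Scope group_scope.

Definition nsubgroups (gT : finGroupType) (G : {set gT}) (a : nat) :=
  #|[set H : {group gT} | (H \subset G) && (#|H| == a)]|.

Lemma isog_nsubgroups (aT rT : finGroupType) (G : {group aT}) (H : {group rT}) a :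
  G \isog H -> nsubgroups G a = nsubgroups H a.
Proof.
suff le (gT hT : finGroupType) (A : {group gT}) (B : {group hT}) :
    A \isog B -> (nsubgroups A a <= nsubgroups B a)%N.
  by move=> GH; apply/eqP; rewrite eqn_leq !le // isog_sym.
case/isogP=> f injf <-.
have inj : {in [set L : {group gT} | (L \subset A) && (#|L| == a)] &,
    injective (fun L : {group gT} => (f @* L)%G)}.
  move=> L M; rewrite !inE => /andP[LA _] /andP[MA _] /(congr1 val) /= E.
  by apply/val_inj/(injm_morphim_inj injf).
rewrite /nsubgroups -(card_in_imset inj); apply: subset_leq_card.
apply/subsetP=> _ /imsetP[L + ->]; rewrite !inE => /andP[LA La].
by rewrite morphimS //= card_injm.
Qed.

Variable gT : finGroupType.
Implicit Types G H : {group gT}.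

Lemma Ldiv_Ldiv G a b : 'Ldiv_a('Ldiv_b(G)) = 'Ldiv_(gcdn a b)(G).
Proof.
apply/setP=> x; rewrite !inE -!order_dvdn dvdn_gcd.
by case: (x \in G); rewrite //= andbC.
Qed.

(** A subgroup of order a is killed by a; so the counts of subgroups of small
    order are known as soon as the torsion of small exponent is, which makes an
    induction on orders possible. *)
Lemma nsubgroups_Ldiv G a : nsubgroups 'Ldiv_a(G) a = nsubgroups G a.
Proof.
apply: eq_card => H; rewrite !inE subsetI.
have [Ha|] := eqVneq #|H| a; rewrite ?andbF // !andbT.
suff -> : H \subset 'Ldiv_a() by rewrite andbT.
by apply/subsetP=> x Hx; rewrite inE -order_dvdn -Ha order_dvdG.
Qed.

Lemma mem_Ldiv_diff G p i x : prime p ->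
  (x \in 'Ldiv_(p ^ i.+1)(G) :\: 'Ldiv_(p ^ i)(G)) =
  (x \in G) && (#[x] == (p ^ i.+1)%N).
Proof.
move=> pp; rewrite !inE -!order_dvdn; case: (x \in G) => //=.
apply/andP/eqP => [[ndv dv]|->]; last first.
  by rewrite dvdnn dvdn_Pexp2l ?prime_gt1 // ltnn.
case/(dvdn_pfactor _ _ pp): dv => m lem xm; rewrite xm in ndv *.
move: ndv; rewrite dvdn_Pexp2l ?prime_gt1 // -ltnNge => lt.
by congr (_ ^ _)%N; apply/eqP; rewrite eqn_leq lem.
Qed.

(** A subgroup of order p^(i+1) which is not killed by p^i is cyclic, and the
    elements of order p^(i+1) are partitioned by the cyclic subgroups that they
    generate, each of which contains totient (p^(i+1)) of them. *)
Lemma card_Ldiv_diff G p i : prime p ->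
  #|'Ldiv_(p ^ i.+1)(G) :\: 'Ldiv_(p ^ i)(G)| =
  (#|[set H : {group gT} | [&& H \subset G, #|H| == p ^ i.+1 & ~~ (H \subset 'Ldiv_(p ^ i)(G))]%N]|
    * totient (p ^ i.+1))%N.
Proof.
move=> pp; set E := _ :\: _; set C := [set H | _].
rewrite -sum1_card (partition_big (fun x => <[x]>%G) (mem C)) /=; last first.
  move=> x; rewrite /E mem_Ldiv_diff // inE cycle_subG => /andP[Gx /eqP ox].
  rewrite Gx -orderE ox eqxx /=; apply/subsetPn; exists x; rewrite ?cycle_id //.
  by rewrite !inE Gx -order_dvdn ox dvdn_Pexp2l ?prime_gt1 // ltnn.
rewrite -sum_nat_const; apply: eq_bigr => H; rewrite inE => /and3P[HG /eqP oH nH].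
have /subsetPn[x Hx] := nH.
have Gx := subsetP HG _ Hx; rewrite inE Gx inE /= -order_dvdn => ndv.
have ox : #[x] = (p ^ i.+1)%N.
  have := order_dvdG Hx; rewrite oH => /(dvdn_pfactor _ _ pp)[m lem xm].
  rewrite xm in ndv *; congr (_ ^ _)%N; move: ndv.
  by rewrite dvdn_Pexp2l ?prime_gt1 // -ltnNge => lt; apply/eqP; rewrite eqn_leq lem.
have defH : H = <[x]>%G.
  by apply/val_inj/esym/eqP; rewrite eqEcard cycle_subG Hx oH -orderE ox leqnn.
rewrite sum1dep_card -ox totient_gen; apply: eq_card => y.
rewrite inE [in RHS]inE /= mem_Ldiv_diff // /generator -val_eqE /= defH.
rewrite (eq_sym <[x]>); have [cE|] := eqVneq <[y]> <[x]>; rewrite ?andbF // andbT.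
have Gy : y \in G by rewrite (subsetP HG) // defH /= -cE cycle_id.
by rewrite Gy orderE cE -orderE ox eqxx.
Qed.

(** The induction step: the p^i-torsion and the number of subgroups of order
    p^(i+1) together determine the size of the p^(i+1)-torsion.  The subgroups
    of order p^(i+1) either lie in the p^i-torsion or are cyclic. *)
Lemma nsubgroups_pfactor G p i : prime p ->
  (#|'Ldiv_(p ^ i.+1)(G)| + totient (p ^ i.+1) * nsubgroups 'Ldiv_(p ^ i)(G) (p ^ i.+1) =
   #|'Ldiv_(p ^ i)(G)| + totient (p ^ i.+1) * nsubgroups G (p ^ i.+1))%N.
Proof.
move=> pp; rewrite -(cardsID 'Ldiv_(p ^ i)(G) 'Ldiv_(p ^ i.+1)(G)) card_Ldiv_diff //.
rewrite (setIidPr _); last first.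
  apply/subsetP=> x; rewrite !inE -!order_dvdn => /andP[-> /= h].
  by rewrite (dvdn_trans h) // dvdn_exp2l.
rewrite -addnA mulnC -mulnDr; congr (_ + _ * _)%N.
rewrite /nsubgroups addnC -[RHS](cardsID [set H : {group gT} | H \subset 'Ldiv_(p ^ i)(G)]).
congr (_ + _)%N; apply: eq_card => H; rewrite !inE.
  by rewrite subsetI; case: (H \subset G); rewrite //= andbC.
by rewrite [RHS]andbC andbA.
Qed.

Lemma card_Ldiv_Sylow G p i : abelian G -> prime p ->
  (logn p #|G| <= i)%N -> #|'Ldiv_(p ^ i)(G)| = (#|G|`_p)%N.
Proof.
move=> cGG pp le; have [P sylP] := Sylow_exists p G.
rewrite -(card_Hall sylP); apply: eq_card => x; rewrite !inE -order_dvdn.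
have nP : P <| G by rewrite -sub_abelian_normal // (pHall_sub sylP).
have -> : (x \in P) = (x \in G) && p.-elt x.
  apply/idP/andP=> [Px|[Gx px]].
    by rewrite (subsetP (pHall_sub sylP)) // (mem_p_elt (pHall_pgroup sylP)).
  by rewrite (mem_normal_Hall sylP nP).
case Gx: (x \in G) => //=.
apply/idP/idP => [dv|px]; first by rewrite /p_elt (pnat_dvd dv) // pnatX pnat_id.
have := order_dvdG Gx; rewrite -{1}(part_pnat_id px) => dv.
have : (#[x] `_ p %| #|G|`_p)%N by rewrite partn_dvd // order_dvdG.
by rewrite part_pnat_id // p_part => h; rewrite (dvdn_trans h) // dvdn_exp2l.
Qed.

End SubgroupCount.

(** * Subsets containing the identity and their stabilisers *)

Section PointedSets.
Variables (T : finType) (x0 : T).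

Lemma setU1_pointed_inj : {in powerset [set~ x0] &, injective (fun B => x0 |: B)}.
Proof.
move=> B C; rewrite !powersetE => sB sC.
move/(congr1 (fun A => A :\ x0)); rewrite !setU1K //.
  by apply/negP=> /(subsetP sC); rewrite !inE eqxx.
by apply/negP=> /(subsetP sB); rewrite !inE eqxx.
Qed.

Lemma card_pointed : #|[set A : {set T} | x0 \in A]| = 2 ^ #|T|.-1.
Proof.
rewrite -(cardsC1 x0) -[RHS](card_powerset [set~ x0]) -(card_in_imset setU1_pointed_inj).
apply: eq_card => A; rewrite inE; apply/idP/imsetP => [Ax|[B _ ->]]; last exact: setU11.
by exists (A :\ x0); rewrite ?setD1K // powersetE subsetDr.
Qed.

Lemma card_pointed_draws m :
  #|[set A : {set T} | (x0 \in A) && (#|A| == m.+1)]| = 'C(#|T|.-1, m).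
Proof.
rewrite -(cardsC1 x0) -cards_draws.
rewrite -[RHS](@card_in_imset _ _ (fun B => x0 |: B)); last first.
  move=> B C; rewrite !inE => /andP[sB _] /andP[sC _].
  by move/setU1_pointed_inj; apply; rewrite powersetE.
apply: eq_card => A; rewrite inE; apply/andP/imsetP => [[Ax Am]|[B]].
  exists (A :\ x0); rewrite ?setD1K // !inE subsetDr.
  by move: Am; rewrite (cardsD1 x0) Ax.
rewrite inE => /andP[sB /eqP <-] ->; rewrite setU11 cardsU1.
suff -> : x0 \notin B by [].
by apply/negP=> /(subsetP sB); rewrite !inE eqxx.
Qed.

(** The involution A |-> {x0} U ~A of the sets containing x0 sends the size
    |A| to |T| + 1 - |A|, so the average size of such a set is (|T| + 1) / 2. *)
Lemma sum_card_pointed :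
  (2 * \sum_(A : {set T} | x0 \in A) #|A| = #|T|.+1 * 2 ^ #|T|.-1)%N.
Proof.
pose phi (A : {set T}) := x0 |: ~: A.
have phiK (A : {set T}) : x0 \in A -> phi (phi A) = A.
  move=> Ax; apply/setP=> y; rewrite !inE; case: eqP => [->|] /=; first by rewrite Ax.
  by rewrite negbK.
rewrite mul2n -addnn {2}(reindex_onto phi phi) /=; last by move=> A; apply: phiK.
have -> : (\sum_(A | (x0 \in phi A) && (phi (phi A) == A)) #|phi A| =
    \sum_(A : {set T} | x0 \in A) #|phi A|)%N.
  apply: eq_bigl => A; rewrite setU11 /=; apply/eqP/idP => [<-|/phiK //].
  exact: setU11.
rewrite -big_split /= -card_pointed [RHS]mulnC -sum_nat_const.
rewrite [RHS](eq_bigl (fun A : {set T} => x0 \in A)); last by move=> A; rewrite inE.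
apply: eq_bigr => A Ax; rewrite cardsU1 inE Ax /= addnCA -[RHS]add1n.
by congr (_ + _)%N; apply: cardsC.
Qed.

End PointedSets.

Section Translates.
Local Open Scope group_scope.
Variable gT : finGroupType.
Implicit Types (A : {set gT}) (H : {group gT}) (m n : nat).

Definition stab A := [set g | g *: A == A].

Lemma stab_group_set A : group_set (stab A).
Proof.
apply/group_setP; rewrite inE lcoset1 eqxx; split=> // x y.
by rewrite !inE lcosetM => /eqP xA /eqP ->; rewrite xA.
Qed.
Canonical stab_group A := Group (stab_group_set A).

(** For abelian G this is m^2 times the number of blocks of m by m matrices of
    K_par(G) over an algebraically closed field of characteristic zero: in the
    groupoid picture, A is an object with |A| incoming arrows, isotropy group
    [stab A], and |A| / |stab A| objects in its connected component. *)
Definition pointed_sets_weight m :=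
  (\sum_(A : {set gT} | (1 \in A)%g && (#|A| == m * #|stab A|)) #|A|)%N.

Hypothesis abelG : abelian [set: gT].

Let normT H : 'N(H) = [set: gT].
Proof.
apply/eqP; rewrite -subTset; apply: subset_trans (cent_sub H).
by rewrite (sub_abelian_cent2 abelG) ?subsetT.
Qed.

Lemma card_cosetpre H (C : {set coset_of H}) :
  #|coset H @*^-1 C| = (#|H| * #|C|)%N.
Proof.
rewrite -sum1_card (partition_big (coset H) (mem C)) /=; last first.
  by move=> x; rewrite !inE => /andP[].
rewrite mulnC -sum_nat_const; apply: eq_bigr => c Cc.
rewrite sum1dep_card -[c]coset_reprK.
rewrite -(card_rcoset H (repr c)); apply: eq_card => x.
have N y : y \in 'N(H) by rewrite normT inE.
rewrite inE; apply/andP/idP=> [[_ /eqP E]|xc].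
  by rewrite -val_coset // -E val_coset // rcoset_refl.
have E : coset H x = coset H (repr c).
  by rewrite [RHS]coset_reprK; apply: coset_mem; rewrite -[c]coset_reprK val_coset.
by rewrite mem_morphpre /= ?E ?coset_reprK.
Qed.

Lemma card_coset_of H : #|{: coset_of H}| = (#|gT| %/ #|H|)%N.
Proof.
have := card_cosetpre [set: coset_of H].
have -> : coset H @*^-1 [set: coset_of H] = [set: gT].
  by rewrite morphpreT; apply: normT.
by rewrite !cardsT => ->; rewrite mulKn.
Qed.

Lemma sub_stabP H A : reflect (H * A = A) (H \subset stab A).
Proof.
apply: (iffP subsetP) => [sHA|HA h Hh].
  apply/setP=> x; apply/mulsgP/idP => [[h y Hh Ay ->]|Ax]; last by exists 1 x; rewrite ?mul1g.
  by have := sHA h Hh; rewrite inE => /eqP <-; rewrite mem_lcoset mulKg.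
rewrite inE eqEcard card_lcoset leqnn andbT -{2}HA.
by rewrite mulSg // sub1set.
Qed.

Lemma dvdn_card_stab A : #|stab A| %| #|A|.
Proof.
have /(sub_stabP (stab_group A)) E := subxx (stab A).
rewrite -{2}E -(@quotientK _ (stab_group A)) ?normT ?subsetT //.
by rewrite card_cosetpre dvdn_mulr.
Qed.

(** Sets stable under H are the unions of cosets of H, that is, the preimages
    of the subsets of the quotient by H. *)
Lemma card_invariant_sets H m :
  #|[set A : {set gT} | [&& 1 \in A, #|A| == (m.+1 * #|H|)%N & H \subset stab A]]| =
  'C((#|gT| %/ #|H|).-1, m).
Proof.
rewrite -card_coset_of -(card_pointed_draws (1 : coset_of H)).
have inj : injective (fun C : {set coset_of H} => coset H @*^-1 C).
  exact: can_inj (@cosetpreK _ H).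
rewrite -(card_imset _ inj); apply: eq_card => A; rewrite inE.
apply/and3P/imsetP => [[A1 cA /sub_stabP HA]|[C + ->]].
  have defA : coset H @*^-1 (A / H) = A by rewrite quotientK ?normT ?subsetT.
  have AH1 : coset H 1 \in A / H by exact: mem_morphim (group1 _) A1.
  rewrite morph1 in AH1.
  exists (A / H); rewrite ?defA // inE AH1 /=.
  by move: cA; rewrite -{1}defA card_cosetpre mulnC eqn_pmul2r.
rewrite inE => /andP[C1 /eqP cC]; split.
- by rewrite mem_morphpre /= ?morph1 // normT inE.
- by rewrite card_cosetpre cC mulnC.
by apply/sub_stabP; rewrite -quotientK ?cosetpreK // subsetIl.
Qed.

(** The order of [stab A] divides both |A| = m |H| and |G|; when m is prime to
    |G| it therefore divides |H|. *)
Lemma stab_coprime H A m : coprime m #|gT| -> #|A| = (m * #|H|)%N ->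
  H \subset stab A -> stab A = H.
Proof.
move=> co cA sHA; apply/esym/eqP; rewrite eqEcard sHA /=.
apply: dvdn_leq => //; have := dvdn_card_stab A; rewrite cA Gauss_dvdr //.
rewrite coprime_sym (coprime_dvdr _ co) // -cardsT.
exact: (cardSg (subsetT (stab_group A))).
Qed.

(** For m + 1 prime to |G| the sets can be sorted by their stabiliser without
    any Moebius inversion over the subgroup lattice. *)
Lemma pointed_sets_weight_coprime m : coprime m.+1 #|gT| ->
  pointed_sets_weight m.+1 =
  (\sum_(a < #|gT|.+1) nsubgroups [set: gT] a * (m.+1 * a * 'C((#|gT| %/ a).-1, m)))%N.
Proof.
move=> co; rewrite /pointed_sets_weight.
rewrite (partition_big stab_group predT) //=.
transitivity (\sum_(H : {group gT}) m.+1 * #|H| * 'C((#|gT| %/ #|H|).-1, m))%N.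
  apply: eq_bigr => H _; rewrite mulnC -card_invariant_sets -sum_nat_const.
  apply: eq_big => [A|A /andP[/andP[_ /eqP cA] /eqP <-]]; last exact: cA.
  rewrite inE -andbA; case: (1 \in A) => //=.
  apply/andP/andP=> [[/eqP cA /eqP <-]|[/eqP cA sHA]]; first by rewrite cA eqxx subxx.
  by have E := stab_coprime co cA sHA; rewrite -val_eqE /= E cA !eqxx.
have le (H : {group gT}) : (#|H| < #|gT|.+1)%N by rewrite ltnS max_card.
rewrite (partition_big (fun H : {group gT} => Ordinal (le H)) predT) //=.
apply: eq_bigr => a _; rewrite /nsubgroups -sum_nat_const.
apply: eq_big => [H|H /eqP <- //].
by rewrite inE subsetT.
Qed.

End Translates.

(** * Recovering an abelian group from the weights *)

Section Recovery.
Local Open Scope group_scope.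

Lemma nsubgroups_ndvd (gT : finGroupType) (G : {group gT}) a :
  ~~ (a %| #|G|) -> nsubgroups G a = 0%N.
Proof.
move=> ndv; apply/eqP; rewrite cards_eq0; apply/eqP/setP=> H; rewrite !inE.
by apply/andP=> -[sHG /eqP oH]; move: ndv; rewrite -oH cardSg.
Qed.

Lemma nsubgroups_full (gT : finGroupType) (G : {group gT}) :
  nsubgroups G #|G| = 1%N.
Proof.
rewrite /nsubgroups -(cards1 G); apply: eq_card => H; rewrite !inE.
apply/andP/eqP=> [[sHG /eqP oH]|->]; last by rewrite subxx eqxx.
by apply/val_inj/eqP; rewrite eqEcard sHG oH /=.
Qed.

(** Every prime divisor of n still divides n / p^i, hence does not divide
    n / p^i - 1. *)
Lemma coprime_pred_quotient n p i : prime p -> (0 < n)%N -> (p ^ i.+1 %| n)%N ->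
  coprime (n %/ p ^ i).-1 n.
Proof.
move=> pp n0 dv; set q := (n %/ p ^ i)%N.
have nE : n = (q * p ^ i)%N by rewrite divnK // (dvdn_trans _ dv) // dvdn_exp2l.
have pq : (p %| q)%N.
  by move: dv; rewrite {1}nE expnS dvdn_pmul2r // expn_gt0 prime_gt0.
have q0 : (0 < q)%N by move: n0; rewrite nE muln_gt0 => /andP[].
have q1 : (1 < q)%N by apply: leq_trans (prime_gt1 pp) (dvdn_leq q0 pq).
rewrite coprime_has_primes //; last by rewrite -subn1 subn_gt0.
apply/hasPn=> r; rewrite mem_primes => /and3P[rp _ rn].
rewrite mem_primes rp /= -subn1 subn_gt0 q1 /=.
have rq : (r %| q)%N.
  move: rn; rewrite nE Euclid_dvdM // => /orP[//|].
  by rewrite Euclid_dvdX // => /andP[+ _]; rewrite dvdn_prime2 // => /eqP->.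
rewrite dvdn_subr //.
by rewrite dvdn1; case: eqP rp => // ->.
Qed.

Variables (gT hT : finGroupType).
Hypotheses (abelG : abelian [set: gT]) (abelH : abelian [set: hT]).
Hypothesis eq_card_gh : #|gT| = #|hT|.
Hypothesis eq_weight :
  forall m, @pointed_sets_weight gT m = @pointed_sets_weight hT m.

Let eq_Ldiv k := #|'Ldiv_k([set: gT])| = #|'Ldiv_k([set: hT])|.

(** The p^j-torsion of the a-torsion is the gcd(p^j, a)-torsion, and this gcd is
    a power of p not exceeding a. *)
Lemma isog_Ldiv a : (0 < a)%N ->
    (forall p j, prime p -> (p ^ j <= a)%N -> eq_Ldiv (p ^ j)) ->
  'Ldiv_a([set: gT]) \isog 'Ldiv_a([set: hT]).
Proof.
move=> a0 eqL.
apply: (@isog_card_Ldiv _ _ (Group (group_Ldiv a abelG)) (Group (group_Ldiv a abelH))).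
- exact: abelianS (subsetT _) abelG.
- exact: abelianS (subsetT _) abelH.
move=> p j pp /=; rewrite !Ldiv_Ldiv.
have /(dvdn_pfactor _ _ pp)[e _ E] := dvdn_gcdl (p ^ j) a.
by rewrite E; apply: eqL; rewrite // -E dvdn_leq // dvdn_gcdr.
Qed.

Lemma eq_nsubgroups_lt k a : (0 < a < k)%N ->
    (forall p j, prime p -> (p ^ j < k)%N -> eq_Ldiv (p ^ j)) ->
  nsubgroups [set: gT] a = nsubgroups [set: hT] a.
Proof.
case/andP=> a0 ak eqL; rewrite -nsubgroups_Ldiv -[RHS]nsubgroups_Ldiv.
apply: (@isog_nsubgroups _ _ (Group (group_Ldiv a abelG)) (Group (group_Ldiv a abelH))).
by apply: isog_Ldiv => // p j pp le; apply: eqL (leq_ltn_trans le ak).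
Qed.

(** The weight at m = |G| / p^i - 1 isolates the subgroups of order k = p^i.
    The coefficient of the subgroups of order a is nonzero only if m - 1 is at
    most |G| / a - 1.  Since m is prime to |G|, orders a > k then contribute
    only for a = |G|, where both groups have one subgroup; orders a < k have
    equal counts by induction. *)
Lemma eq_nsubgroups_pfactor p i : prime p -> (p ^ i.+1 %| #|gT|)%N ->
    (forall q j, prime q -> (q ^ j < p ^ i)%N -> eq_Ldiv (q ^ j)) ->
  nsubgroups [set: gT] (p ^ i) = nsubgroups [set: hT] (p ^ i).
Proof.
move=> pp dv eqL.
have n0 : (0 < #|gT|)%N by rewrite -cardsT cardG_gt0.
(* q = |G| / k, and the weight is taken at q - 1 = m. *)
have co := coprime_pred_quotient pp n0 dv.
move: co; set n := #|gT|; set k := (p ^ i)%N; set q := (n %/ k)%N => co.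
have k0 : (0 < k)%N by rewrite expn_gt0 prime_gt0.
have nE : n = (q * k)%N by rewrite divnK // (dvdn_trans _ dv) // dvdn_exp2l.
have pq : (p %| q)%N by move: dv; rewrite -/n nE expnS dvdn_pmul2r.
have q0 : (0 < q)%N by move: n0; rewrite -/n nE muln_gt0 => /andP[].
have q1 : (1 < q)%N by apply: leq_trans (prime_gt1 pp) (dvdn_leq q0 pq).
have qE : q.-1 = q.-2.+1 by case: (q) q1 => [|[]].
have := eq_weight q.-1; rewrite qE !pointed_sets_weight_coprime ?eq_card_gh -?qE //;
  rewrite -?eq_card_gh //.
have kn : (k < n.+1)%N by rewrite ltnS (dvdn_leq n0) //= -/n nE dvdn_mull.
rewrite [LHS](bigD1 (Ordinal kn)) //= [RHS](bigD1 (Ordinal kn)) //= -/n -/q.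
set A := (\sum_(a < _ | _) _)%N; set B := (\sum_(a < _ | _) _)%N.
(* The terms other than a = k agree. *)
have -> : A = B.
  apply: eq_bigr => a; rewrite -val_eqE /= => ak.
  have [a0|a0] := posnP a; first by rewrite a0 muln0 mul0n !muln0.
  have [lt|le] := ltnP a k.
    by congr (_ * _)%N; apply: (@eq_nsubgroups_lt k); rewrite ?a0.
  have {ak le} lt : (k < a)%N by rewrite ltn_neqAle eq_sym ak.
  have [an|nan] := boolP (a %| n)%N; last first.
    by rewrite !nsubgroups_ndvd // cardsT -?eq_card_gh.
  have [->|na] := eqVneq (a : nat) n.
    rewrite {1}/n -cardsT nsubgroups_full /n eq_card_gh -cardsT.
    by rewrite nsubgroups_full.
  (* n %/ a = q - 1 would make q - 1 a divisor of n prime to n, so a = n. *)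
  have naq : (n %/ a < q.-1)%N.
    have naE : n = (n %/ a * a)%N by rewrite divnK.
    have ltq : (n %/ a < q)%N by rewrite ltn_divLR // {1}nE ltn_pmul2l.
    have leq : (n %/ a <= q.-1)%N by rewrite -ltnS prednK.
    rewrite ltn_neqAle leq andbT; apply/eqP=> E.
    have dvn : (n %/ a %| n)%N by apply/dvdnP; exists (a : nat); rewrite mulnC.
    have := coprime_dvdr dvn co; rewrite -E /coprime gcdnn => /eqP E1.
    by case/eqP: na; rewrite [RHS]naE E1 mul1n.
  rewrite bin_small ?muln0 //.
  have : (0 < n %/ a)%N by rewrite divn_gt0 // dvdn_leq.
  by lia.
move/addIn/eqP; rewrite eqn_pmul2r => [/eqP //|].
rewrite !muln_gt0 k0 -subn1 subn_gt0 q1 /= bin_gt0.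
by rewrite leq_pred.
Qed.

(** Strong induction on the prime power p^i, over all primes at once.  Below
    the exact power of p in |G| the subgroup counts are available; from that
    power on, the torsion is the whole Sylow subgroup. *)
Lemma eq_card_Ldiv_pfactor p i : prime p -> eq_Ldiv (p ^ i).
Proof.
have [k] := ubnP (p ^ i); elim: k p i => // k IHk p i le pp.
have [le_i|lt_i] := leqP (logn p #|gT|) i.
  rewrite /eq_Ldiv !card_Ldiv_Sylow ?cardsT -?eq_card_gh //.
case: i le lt_i => [|i] le lt_i.
  rewrite /eq_Ldiv expn0.
  have L1 (rT : finGroupType) : 'Ldiv_1([set: rT]) = [1].
    by apply/setP=> x; rewrite !inE expg1.
  by rewrite !L1 !cards1.
have n0 : (0 < #|gT|)%N by rewrite -cardsT cardG_gt0.
have eqL q j : prime q -> (q ^ j < p ^ i.+1)%N -> eq_Ldiv (q ^ j).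
  by move=> qp ltq; apply: IHk => //; apply: leq_trans ltq _.
have lt_p : (p ^ i < p ^ i.+1)%N by rewrite ltn_exp2l ?prime_gt1.
have dv : (p ^ i.+2 %| #|gT|)%N by rewrite pfactor_dvdn.
have := nsubgroups_pfactor [set: hT]%G i pp.
have := nsubgroups_pfactor [set: gT]%G i pp => /=.
rewrite (eq_nsubgroups_pfactor pp dv eqL) (eqL p i pp lt_p).
have -> : nsubgroups 'Ldiv_(p ^ i)([set: gT]) (p ^ i.+1) =
          nsubgroups 'Ldiv_(p ^ i)([set: hT]) (p ^ i.+1).
  apply: (@isog_nsubgroups _ _ (Group (group_Ldiv _ abelG)) (Group (group_Ldiv _ abelH))).
  apply: isog_Ldiv => [|q j qp ltq]; first by rewrite expn_gt0 prime_gt0.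
  exact: eqL qp (leq_ltn_trans ltq lt_p).
by move=> <- /addIn.
Qed.

Theorem isog_pointed_sets_weight : [set: gT] \isog [set: hT].
Proof.
by apply: isog_card_Ldiv => // p j pp; apply: eq_card_Ldiv_pfactor.
Qed.

End Recovery.

Import GRing.Theory.
Local Open Scope ring_scope.

(** * Partial representations and their projections *)

Section PartialRepresentation.
Variables (K : fieldType) (gT : finGroupType) (R : algType K) (u : gT -> R).
Hypothesis uP : par_relations u.
Implicit Types (g h s t : gT) (A B : {set gT}).

Let u1 : u 1%g = 1. Proof. by case: uP. Qed.

Lemma par_mulVM s t : u s^-1%g * u s * u t = u s^-1%g * u (s * t)%g.
Proof. by case: uP. Qed.

Lemma par_mulMV s t : u s * u t * u t^-1%g = u (s * t)%g * u t^-1%g.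
Proof. by case: uP. Qed.

Lemma par_VM s t : u s * u s^-1%g * u t = u s * u (s^-1 * t)%g.
Proof. by have := par_mulVM s^-1%g t; rewrite invgK. Qed.

Definition par_idem g := u g * u g^-1%g.
Local Notation e := par_idem.

Lemma par_idem1 : e 1%g = 1.
Proof. by rewrite /e invg1 u1 mulr1. Qed.

Lemma par_idemM g : e g * u g = u g.
Proof. by rewrite /e par_VM mulVg u1 mulr1. Qed.

Lemma par_idem_idem g : e g * e g = e g.
Proof. by rewrite {2}/e mulrA par_idemM. Qed.

(** The range idempotents are permuted by the generators; their commutation
    follows, since e s = u s * u s^-1 moves e t to itself. *)
Lemma par_mul_idemC t s : u t * e s = e (t * s)%g * u t.
Proof.
by rewrite /e mulrA par_mulMV par_VM invMg mulgKV.
Qed.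

Lemma par_idemC s t : e s * e t = e t * e s.
Proof.
by rewrite {1}/e -mulrA par_mul_idemC mulrA par_mul_idemC mulgA mulgV mul1g -mulrA.
Qed.

Definition par_factor A g : R := if g \in A then e g else 1 - e g.

(** The indicator of the set A: the product of commuting idempotents that cuts
    out the part where exactly the e g with g in A act as the identity.  In the
    groupoid picture it is the identity arrow of the object A. *)
Definition par_proj A : R := \prod_g par_factor A g.
Local Notation P := par_proj.

Lemma par_idem_factor A g : e g * par_factor A g = if g \in A then par_factor A g else 0.
Proof.
rewrite /par_factor; case: ifP => _; first exact: par_idem_idem.
by rewrite mulrBr mulr1 par_idem_idem subrr.
Qed.

Lemma par_factorC A g h : e g * par_factor A h = par_factor A h * e g.
Proof.
rewrite /par_factor; case: ifP => _; first exact: par_idemC.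
by rewrite mulrBr mulrBl mulr1 mul1r par_idemC.
Qed.

Lemma par_idem_projC A g : e g * P A = P A * e g.
Proof.
rewrite /P; elim: (index_enum _) => [|h s IHs]; first by rewrite big_nil mulr1 mul1r.
by rewrite big_cons mulrA par_factorC -mulrA IHs mulrA.
Qed.

Lemma par_idem_proj A g : e g * P A = if g \in A then P A else 0.
Proof.
rewrite /P; have := mem_index_enum g.
elim: (index_enum _) => [//|h s IHs]; rewrite inE big_cons => /predU1P[<-|/IHs E].
  by rewrite mulrA par_idem_factor; case: ifP => _ //; rewrite mul0r.
by rewrite mulrA par_factorC -mulrA E; case: ifP => _ //; rewrite mulr0.
Qed.

Lemma par_proj_idem A g : P A * e g = if g \in A then P A else 0.
Proof. by rewrite -par_idem_projC par_idem_proj. Qed.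

Lemma sum_par_proj : \sum_A P A = 1.
Proof.
rewrite -(@bigA_distr _ 0 1 *%R +%R gT e (fun g => 1 - e g)) big1 // => g _.
by rewrite /= addrCA subrr addr0.
Qed.

Lemma par_proj_unit0 A : 1%g \notin A -> P A = 0.
Proof.
move=> A1; rewrite -[P A]mul1r -par_idem1 par_idem_proj.
by rewrite (negbTE A1).
Qed.

(** The joint eigenvalues of the e g on X determine which projection fixes X.
    Working with these eigenvalues avoids reordering the noncommutative product
    that defines [par_proj]. *)
Lemma par_proj_uniq X A B : A != B ->
  (forall g, X * e g = if g \in A then X else 0) -> X * P B = 0.
Proof.
move=> neqAB Xe; have [g gAB] : exists g, (g \in A) != (g \in B).
  apply/existsP; apply: contraR neqAB; rewrite negb_exists => /forallP E.
  by apply/eqP/setP=> g; have := E g; rewrite negbK => /eqP.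
have := congr1 (fun Y => X * Y) (par_idem_proj B g).
rewrite mulrA Xe; case: ifP gAB => _; case: ifP => _ // _; first by rewrite mulr0.
by rewrite mul0r => <-.
Qed.

Lemma par_proj_orth A B : A != B -> P A * P B = 0.
Proof. by move/par_proj_uniq; apply => g; exact: par_proj_idem. Qed.

Lemma par_proj_idem2 A : P A * P A = P A.
Proof.
rewrite -[RHS]mulr1 -sum_par_proj mulr_sumr (bigD1 A) //= big1 ?addr0 // => B.
by rewrite eq_sym => /par_proj_orth.
Qed.

Lemma par_projM A B : P A * P B = if A == B then P A else 0.
Proof.
by case: eqP => [<-|/eqP/par_proj_orth //]; exact: par_proj_idem2.
Qed.

(** Compare e (t g) u t = u t e g on both sides: P B * u t * P A can only be
    nonzero if t g in B is equivalent to g in A, that is, if B = t A. *)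
Lemma par_mul_proj t A : u t * P A = P (t *: A)%g * u t.
Proof.
have E B : B != (t *: A)%g -> P B * u t * P A = 0.
  move=> BA; have BA' : (t^-1 *: B)%g != A.
    by apply: contraNneq BA => <-; rewrite -lcosetM mulgV lcoset1.
  apply: par_proj_uniq BA' _ => g.
  rewrite -mulrA par_mul_idemC mulrA par_proj_idem mem_lcoset invgK.
  by case: ifP => _ //; rewrite mul0r.
transitivity (P (t *: A)%g * u t * P A).
  rewrite -[LHS]mul1r -{1}sum_par_proj mulr_suml (bigD1 (t *: A)%g) //= big1.
    by rewrite addr0 mulrA.
  by move=> B /E; rewrite mulrA.
rewrite -[RHS]mulr1 -sum_par_proj mulr_sumr (bigD1 A) //= big1 ?addr0 // => B.
rewrite eq_sym => AB; apply: par_proj_uniq AB _ => g.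
rewrite -mulrA par_mul_idemC mulrA par_proj_idem mem_lcoset mulKg.
by case: ifP => _ //; rewrite mul0r.
Qed.

Lemma par_proj_mulC t A : P A * u t = u t * P (t^-1 *: A)%g.
Proof. by rewrite par_mul_proj -lcosetM mulgV lcoset1. Qed.

Lemma par_proj_gen g A : g \notin A -> P A * u g = 0.
Proof.
by move=> gA; rewrite -par_idemM mulrA par_proj_idem (negbTE gA) mul0r.
Qed.

(** Composition of the arrows P A * u g in the groupoid. *)
Lemma par_proj_genM A g h :
  P A * u g * u h = if g \in A then P A * u (g * h)%g else 0.
Proof.
case: ifP => [gA|/negbT/par_proj_gen->]; last by rewrite mul0r.
rewrite -{1}par_idemM mulrA par_proj_idem gA.
have -> : P A * u (g * h)%g = P A * e g * u (g * h)%g by rewrite par_proj_idem gA.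
by rewrite -!mulrA; congr (_ * _); rewrite !mulrA /e par_VM mulKg.
Qed.

End PartialRepresentation.

(** * Symmetric separability idempotents *)

Section Separability.
Variables (K : fieldType) (A : algType K).

(** Bilinear maps out of A x A stand for linear maps out of the tensor square,
    so that a family of pairs (x i, y i) can be treated as the tensor
    sum_i x i (x) y i. *)
Definition bilin (V : lmodType K) (F : A -> A -> V) :=
  (forall y, linear (F^~ y)) /\ (forall x, linear (F x)).

Lemma bilin0l (V : lmodType K) (F : A -> A -> V) y : bilin F -> F 0 y = 0.
Proof.
by case=> /(_ y) lF _; have := lF (-1) 0 0; rewrite scaler0 addr0 scaleN1r addNr.
Qed.

Lemma bilinC (V : lmodType K) (F : A -> A -> V) :
  bilin F -> bilin (fun x y => F y x).
Proof. by case. Qed.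

Lemma bilin0r (V : lmodType K) (F : A -> A -> V) x : bilin F -> F x 0 = 0.
Proof. by move/bilinC/bilin0l; apply. Qed.

Lemma bilinZl (V : lmodType K) (F : A -> A -> V) c x y :
  bilin F -> F (c *: x) y = c *: F x y.
Proof. by move=> bF; have := bF.1 y c x 0; rewrite !addr0 bilin0l // addr0. Qed.

Lemma bilinZr (V : lmodType K) (F : A -> A -> V) c x y :
  bilin F -> F x (c *: y) = c *: F x y.
Proof. by move/bilinC/bilinZl; apply. Qed.

Lemma bilin_comp (V : lmodType K) (F : A -> A -> V) (f g : A -> A) :
  linear f -> linear g -> bilin F -> bilin (fun x y => F (f x) (g y)).
Proof.
move=> lf lg [Fl Fr]; split=> [y c x x'|x c y y']; first by rewrite lf Fl.
by rewrite lg Fr.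
Qed.

Lemma linear_mull (a : A) : linear (fun x => a * x).
Proof. by move=> c x y; rewrite mulrDr scalerAr. Qed.

Lemma linear_mulr (a : A) : linear (fun x => x * a).
Proof. by move=> c x y; rewrite mulrDl scalerAl. Qed.

Lemma linear_id : linear (fun x : A => x).
Proof. by []. Qed.

Lemma bilin_mul (a b : A) : bilin (fun x y : A => a * x * b * y).
Proof.
split=> [y|x] c z z'; last exact: linear_mull.
by rewrite mulrDr !mulrDl -scalerAr -!scalerAl.
Qed.

Lemma bilin_sumr (V : lmodType K) (F : A -> A -> V) x (I : finType) (y : I -> A) :
  bilin F -> F x (\sum_i y i) = \sum_i F x (y i).
Proof.
move=> bF; apply: (big_morph (F x)) => [a b|]; last exact: bilin0r.
by have := bF.2 x 1 a b; rewrite !scale1r.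
Qed.

(** The tensor t = sum_i x i (x) y i is a symmetric separability idempotent:
    its product is 1, the flip fixes it, and (a (x) 1) t = t (1 (x) a). *)
Record sym_sep_idem (I : finType) (x y : I -> A) : Prop := SymSepIdem {
  sep_mul : \sum_i x i * y i = 1;
  sep_sym : forall (V : lmodType K) (F : A -> A -> V), bilin F ->
    \sum_i F (x i) (y i) = \sum_i F (y i) (x i);
  sep_comm : forall (V : lmodType K) (F : A -> A -> V) a, bilin F ->
    \sum_i F (a * x i) (y i) = \sum_i F (x i) (y i * a) }.

(** For t = sum x i (x) y i and s = sum u j (x) v j, form
    sum x i u j (x) v j y i.  Moving x i through s gives s, because
    sum x i y i = 1; moving u j through t, after a flip, gives t, because
    sum v j u j = 1. *)
Lemma sym_sep_idem_uniq (I J : finType) (x y : I -> A) (u v : J -> A)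
    (V : lmodType K) (F : A -> A -> V) :
    sym_sep_idem x y -> sym_sep_idem u v -> bilin F ->
  \sum_i F (x i) (y i) = \sum_j F (u j) (v j).
Proof.
move=> [xy1 xys xyc] [uv1 uvs uvc] bF.
transitivity (\sum_i \sum_j F (x i * u j) (v j * y i)).
  have vu1 : \sum_j v j * u j = 1.
    rewrite -uv1; apply/esym; have := uvs _ _ (bilin_mul 1 1).
    by under eq_bigr do rewrite mulr1 mul1r; under [in RHS]eq_bigr do rewrite mulr1 mul1r.
  rewrite exchange_big /= xys //.
  transitivity (\sum_i \sum_j F (y i * (v j * u j)) (x i)).
    apply: eq_bigr => i _.
    by rewrite -(bilin_sumr _ _ (bilinC bF)) -mulr_sumr vu1 mulr1.
  rewrite exchange_big; apply: eq_bigr => j _ /=.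
  have bG := bilin_comp (@linear_mulr (u j)) (@linear_mull (v j)) bF.
  rewrite (xys _ _ bG) /=.
  have bH := bilin_comp linear_id (@linear_mulr (u j)) (bilinC bF).
  have /= -> := xyc _ _ (v j) bH.
  by apply: eq_bigr => i _; rewrite mulrA.
transitivity (\sum_i \sum_j F (u j) (v j * (x i * y i))).
  apply: eq_bigr => i _.
  have bG := bilin_comp linear_id (@linear_mulr (y i)) bF.
  have /= -> := uvc _ _ (x i) bG.
  by apply: eq_bigr => j _; rewrite mulrA.
rewrite exchange_big; apply: eq_bigr => j _ /=.
by rewrite -(bilin_sumr _ _ bF) -mulr_sumr xy1 mulr1.
Qed.

(** On a matrix block M_m(K) the separability idempotent is
    (1 / m) sum E_ab (x) E_ba, and this element is the scalar 1 / m^2: it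
    remembers the size of each block. *)
Definition casimir (I : finType) (x y : I -> A) :=
  \sum_i \sum_j x i * x j * y i * y j.

(** The expression is bilinear in each of the two copies of the separability
    idempotent, which is unique. *)
Lemma casimir_uniq (I J : finType) (x y : I -> A) (u v : J -> A) :
  sym_sep_idem x y -> sym_sep_idem u v -> casimir x y = casimir u v.
Proof.
move=> xy uv; rewrite /casimir.
under eq_bigr => i _ do rewrite (sym_sep_idem_uniq xy uv (bilin_mul _ _)).
rewrite exchange_big /= [RHS]exchange_big /=; apply: eq_bigr => j _.
have bF : bilin (fun p q : A => p * u j * q * v j).
  split=> [q|p] c z z'; first by rewrite !mulrDl -!scalerAl.
  by rewrite mulrDr mulrDl -scalerAr -scalerAl.
exact: (sym_sep_idem_uniq xy uv bF).
Qed.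

End Separability.

Section Transport.
Variables (K : fieldType) (A B : algType K) (f : {lrmorphism A -> B}).

Lemma sym_sep_idem_morph (I : finType) (x y : I -> A) : bijective f ->
  sym_sep_idem x y -> sym_sep_idem (f \o x) (f \o y).
Proof.
move=> [g fK gK] [xy1 xys xyc].
have bP (V : lmodType K) (F : B -> B -> V) : bilin F ->
    bilin (fun p q => F (f p) (f q)).
  move=> [Fl Fr]; split=> [q|p] c z z'; first by rewrite linearP Fl.
  by rewrite linearP Fr.
split=> [|V F bF|V F b bF] /=.
- by rewrite -(rmorph1 f) -xy1 rmorph_sum; apply: eq_bigr => i _; rewrite rmorphM.
- exact: xys (bP _ _ bF).
have := xyc _ _ (g b) (bP _ _ bF) => /=.
under eq_bigr do rewrite rmorphM /= gK; move=> ->.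
by apply: eq_bigr => i _; rewrite rmorphM /= gK.
Qed.

Lemma casimir_morph (I : finType) (x y : I -> A) :
  f (casimir x y) = casimir (f \o x) (f \o y).
Proof.
rewrite rmorph_sum; apply: eq_bigr => i _; rewrite rmorph_sum.
by apply: eq_bigr => j _; rewrite !rmorphM.
Qed.

End Transport.

(** Steinitz bound for families in a module with no chosen basis. *)
Lemma free_span_leq (K : fieldType) (V : lmodType K) (I J : finType)
    (P : {set I}) (Q : {set J}) (b : I -> V) (b' : J -> V) :
    (forall c : I -> K, \sum_(i in P) c i *: b i = 0 -> {in P, forall i, c i = 0}) ->
    {in P, forall i, exists d : J -> K, b i = \sum_(j in Q) d j *: b' j} ->
  (#|P| <= #|Q|)%N.
Proof.
move=> free span; rewrite leqNgt; apply/negP=> ltQP.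
have [d dE] : exists d : 'I_#|P| -> J -> K,
    forall i, b (enum_val i) = \sum_(j in Q) d i j *: b' j.
  apply: (@fin_all_exists _ (fun=> J -> K)
    (fun i di => b (enum_val i) = \sum_(j in Q) di j *: b' j)) => i.
  exact: span (enum_valP i).
pose M : 'M[K]_(#|P|, #|Q|) := \matrix_(i, j) d i (enum_val j).
have /rowV0Pn[w /sub_kermxP wM w0] : kermx M != 0.
  rewrite kermx_eq0 /row_free neq_ltn; apply/orP; left.
  exact: leq_ltn_trans (rank_leq_col M) ltQP.
pose c x := \sum_i w 0 i * (enum_val i == x)%:R.
have cE i : c (enum_val i) = w 0 i.
  rewrite /c (bigD1 i) //= eqxx mulr1 big1 ?addr0 // => k ki.
  by rewrite (inj_eq enum_val_inj) (negbTE ki) mulr0.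
case/eqP: w0; apply/rowP=> i; rewrite mxE -cE; apply: free (enum_valP i).
rewrite big_enum_val /=.
under eq_bigr do rewrite cE dE big_enum_val /= scaler_sumr.
rewrite exchange_big /= big1 // => j _.
under eq_bigr do rewrite scalerA; rewrite -scaler_suml.
have /matrixP/(_ 0 j) := wM; rewrite !mxE => wMj.
under eq_bigr => k _ do [rewrite (_ : d k (enum_val j) = M k j); last by rewrite mxE].
by rewrite wMj scale0r.
Qed.

(** * The Casimir element of a partial representation *)

Section CasimirOfPartialRepresentation.
Variables (K : fieldType) (gT : finGroupType) (R : algType K) (u : gT -> R).
Hypothesis uP : par_relations u.
Implicit Types (g h s t : gT) (A B : {set gT}).
Local Notation P := (par_proj u).

Lemma par_genM_proj h g A : (g^-1)%g \in A ->
  u h * u g * P A = u (h * g)%g * P A.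
Proof.
move=> gA; have <- : par_idem u g^-1%g * P A = P A by rewrite par_idem_proj // gA.
by rewrite /par_idem invgK !mulrA par_mulMV.
Qed.

(** The tensor of arrows (1 / |A|) a (x) a^-1 of the groupoid, where A is the
    target of a and |A| the number of arrows with target A.  The index runs
    over all pairs, so that translations act on it by bijections; the terms
    whose k is not in A vanish. *)
Definition sep_left (p : {set gT} * gT) : R := #|p.1|%:R^-1 *: (P p.1 * u p.2).
Definition sep_right (p : {set gT} * gT) : R := u p.2^-1%g * P p.1.

Lemma sum_sep_mul : [pchar K] =i pred0 -> \sum_p sep_left p * sep_right p = 1.
Proof.
move=> char0; rewrite -(sum_par_proj u).
rewrite -(pair_bigA _ (fun A k => sep_left (A, k) * sep_right (A, k))) /=.
apply: eq_bigr => A _; have [->|A0] := eqVneq A set0.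
  rewrite (par_proj_unit0 uP) ?inE // big1 // => k _.
  by rewrite /sep_right /= (par_proj_unit0 uP) ?inE // !mulr0.
transitivity (\sum_(k in A) #|A|%:R^-1 *: P A).
  rewrite [RHS]big_mkcond; apply: eq_bigr => k _; rewrite /sep_left /sep_right /=.
  rewrite -scalerAl mulrA par_proj_genM // mulgV.
  case: uP => -> _ _; rewrite mulr1.
  by case: ifP => _; rewrite ?mul0r ?scaler0 // par_projM ?eqxx.
rewrite sumr_const -scaler_nat scalerA mulfV ?scale1r //.
by have /pcharf0P -> := char0; rewrite cards_eq0.
Qed.

(** Inversion of arrows, (A, k) |-> (k^-1 A, k^-1), exchanges the factors. *)
Lemma sep_symmetric (V : lmodType K) (F : R -> R -> V) : bilin F ->
  \sum_p F (sep_left p) (sep_right p) = \sum_p F (sep_right p) (sep_left p).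
Proof.
move=> bF.
pose phi (p : {set gT} * gT) := (p.2^-1 *: p.1, p.2^-1)%g.
have phiK : involutive phi.
  by case=> A k; rewrite /phi /= invgK -lcosetM mulgV lcoset1.
rewrite [RHS](reindex_inj (inv_inj phiK)) /=; apply: eq_bigr => -[A k] _.
rewrite /sep_left /sep_right /phi /= bilinZl // bilinZr // card_lcoset invgK.
by rewrite [u k * _]par_mul_proj // -lcosetM mulgV lcoset1 [u k^-1%g * P A]par_mul_proj.
Qed.

(** Left multiplication by g carries the term at (A, k) to the one at
    (g A, g k); the two sides fail to match only when A or g A does not contain
    1, and then both vanish. *)
Lemma sep_comm_gen (V : lmodType K) (F : R -> R -> V) g : bilin F ->
  \sum_p F (u g * sep_left p) (sep_right p) = \sum_p F (sep_left p) (sep_right p * u g).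
Proof.
move=> bF.
pose phi (p : {set gT} * gT) := (g *: p.1, g * p.2)%g.
have phi_inj : injective phi.
  apply: (@can_inj _ _ _ (fun p => (g^-1 *: p.1, g^-1 * p.2)%g)) => -[A k].
  by rewrite /phi /= mulKg -lcosetM mulVg lcoset1.
rewrite [RHS](reindex_inj phi_inj) /=; apply: eq_bigr => -[A k] _.
rewrite /sep_left /sep_right /phi /= -scalerAr !bilinZl // card_lcoset; congr (_ *: _).
rewrite mulrA -[_ * u g]mulrA -par_mul_proj // [u (g * k)^-1%g * _]mulrA.
rewrite [u g * P A]par_mul_proj //.
have [A1|/(par_proj_unit0 uP) PA] := boolP (1%g \in A); last first.
  by rewrite PA !mulr0 !bilin0r.
have [gA|] := boolP (g^-1%g \in A); last first.
  move=> gA; have /(par_proj_unit0 uP) -> : 1%g \notin (g *: A)%g.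
    by rewrite mem_lcoset mulg1.
  by rewrite !mul0r !bilin0l.
by rewrite par_proj_genM // mem_lcoset mulVg A1 par_genM_proj // invMg mulgKV.
Qed.

Hypothesis abelG : abelian [set: gT].

Let mulg_comm (x y : gT) : (x * y)%g = (y * x)%g.
Proof. by apply: (centsP abelG); rewrite inE. Qed.

Lemma stab_projC A s : s \in stab A -> u s * P A = P A * u s.
Proof. by rewrite inE => /eqP sA; rewrite par_mul_proj // sA. Qed.

(** The product of the four arrows k, l, k^-1, l^-1 is composable only if k
    and l are loops at A; it is then a commutator in the abelian isotropy group
    of A, hence the identity of A. *)
Lemma casimir_term A k B l :
  P A * u k * (P B * u l) * (u k^-1%g * P A) * (u l^-1%g * P B) =
  if [&& B == A, k \in stab A & l \in stab A] then P A else 0.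
Proof.
have [/and3P[/eqP-> kS lS]|] := ifPn; last first.
  move=> nABkl.
  (* Each adjacent pair of projections must agree once they are brought together:
     A = k B, A = l^-1 B and B = l k^-1 A, which force A = B = k A = l A. *)
  have [E1|kBA] := eqVneq A (k *: B)%g; last first.
    rewrite [_ * (P B * u l)]mulrA -(mulrA (P A) (u k)) [u k * P B]par_mul_proj //.
    by rewrite [P A * _]mulrA par_projM // (negbTE kBA) !mul0r.
  have [E2|lBA] := eqVneq A (l^-1 *: B)%g; last first.
    rewrite [u l^-1%g * P B]par_mul_proj // [_ * (u k^-1%g * P A)]mulrA.
    rewrite -[_ * P A * _]mulrA [P A * (_ * _)]mulrA par_projM //.
    by rewrite (negbTE lBA) mul0r mulr0.
  have [E3|lkAB] := eqVneq B (l *: (k^-1 *: A))%g; last first.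
    rewrite [u k^-1%g * P A]par_mul_proj // -[_ * (P B * u l) * _]mulrA.
    rewrite -[P B * u l * _]mulrA [u l * _]mulrA par_mul_proj // -!mulrA.
    by rewrite [P B * (P _ * _)]mulrA par_projM // (negbTE lkAB) !(mul0r, mulr0).
  have E4 : (k^-1 *: A)%g = B by rewrite E1 -lcosetM mulVg lcoset1.
  have lB : (l *: B)%g = B by rewrite {2}E3 E4.
  have BA : B = A by rewrite E2 -{2}lB -lcosetM mulVg lcoset1.
  move: E1 lB nABkl; rewrite BA => E1 lA.
  by rewrite !inE -E1 lA !eqxx.
have [A1|/(par_proj_unit0 uP) PA] := boolP (1%g \in A); last first.
  by rewrite PA !mulr0.
have kV : (k^-1)%g \in stab A by rewrite groupV.
have lV : (l^-1)%g \in stab A by rewrite groupV.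
have sA s : s \in stab A -> s \in A.
  by rewrite inE => /eqP <-; rewrite mem_lcoset mulVg.
have absorb s : s \in stab A -> P A * u s * P A = P A * u s.
  by move=> sS; rewrite -mulrA stab_projC // mulrA par_projM // eqxx.
have step s t : s \in stab A -> P A * u s * u t = P A * u (s * t)%g.
  by move=> sS; rewrite par_proj_genM // sA.
rewrite (stab_projC kV) (stab_projC lV) !mulrA.
rewrite absorb // step // absorb ?groupM // step ?groupM // absorb ?groupM //.
rewrite step ?groupM // (mulg_comm k l) mulgK mulgV.
by case: uP => -> _ _; rewrite mulr1.
Qed.

End CasimirOfPartialRepresentation.

Section CasimirValue.
Variables (K : fieldType) (gT : finGroupType) (R : algType K) (u : gT -> R).
Hypothesis uP : par_relations u.
Hypothesis abelG : abelian [set: gT].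
Local Notation P := (par_proj u).

Definition casimir_eigenval (A : {set gT}) : K := (#|stab A|%:R / #|A|%:R) ^+ 2.

(** Only the |stab A|^2 pairs of loops at A contribute, each 1 / |A|^2. *)
Lemma par_casimirE :
  casimir (sep_left u) (sep_right u) = \sum_A casimir_eigenval A *: P A.
Proof.
pose x := sep_left u; pose y := sep_right u.
transitivity (\sum_A \sum_k \sum_B \sum_l x (A, k) * x (B, l) * y (A, k) * y (B, l)).
  rewrite pair_bigA; apply: eq_bigr => -[A k] _ /=.
  by rewrite pair_bigA; apply: eq_bigr => -[B l] _.
apply: eq_bigr => A _.
transitivity (\sum_(k in stab A) \sum_(l in stab A) #|A|%:R ^- 2 *: P A); last first.
  rewrite !sumr_const -!mulrnA -scaler_nat scalerA; congr (_ *: _).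
  by rewrite /casimir_eigenval expr_div_n natrM expr2.
rewrite [RHS]big_mkcond /=; apply: eq_bigr => k _.
rewrite (bigD1 A) //= [X in _ + X]big1 ?addr0.
  case: ifP => kS; last rewrite big1 //; [rewrite [RHS]big_mkcond /=; apply: eq_bigr|] => l _;
  rewrite /x /y /sep_left /sep_right /= -!(scalerAl, scalerAr) casimir_term // eqxx kS /=.
    by case: ifP => _; rewrite scalerA ?scaler0 // -invfM expr2.
  by rewrite !scaler0.
move=> B BA; rewrite big1 // => l _.
rewrite /x /y /sep_left /sep_right /= -!(scalerAl, scalerAr) casimir_term //.
by rewrite (negbTE BA) !scaler0.
Qed.

End CasimirValue.

Section PartialAlgebra.
Variables (K : fieldType) (gT : finGroupType).
Local Notation R := (par_algebra K gT).
Local Notation u := (@par_gen K gT).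
Local Notation P := (par_proj u).
Let uP := par_gen_relations K gT.

Lemma par_algebra_ind (Q : R -> Prop) :
    (forall g, Q (u g)) -> Q 1 -> (forall c x y, Q x -> Q y -> Q (c *: x + y)) ->
    (forall x y, Q x -> Q y -> Q (x * y)) ->
  forall x, Q x.
Proof.
move=> Qg Q1 Ql QM.
have Q0 : Q 0 by rewrite -(addNr (1 : R)) -scaleN1r; apply: Ql.
elim/quotW; elim=> [g|||x IHx|x IHx y IHy|x IHx y IHy|c x IHx] //.
- exact: Qg.
- apply: (eq_ind_r Q _ (par_piN x)); have := Ql (-1) _ _ IHx Q0.
  by rewrite addr0 scaleN1r.
- apply: (eq_ind_r Q _ (par_piD x y)); have := Ql 1 _ _ IHx IHy.
  by rewrite scale1r.
- by apply: (eq_ind_r Q _ (par_piM x y)); apply: QM.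
- apply: (eq_ind_r Q _ (par_piZ c x)); have := Ql c _ _ IHx Q0.
  by rewrite addr0.
Qed.

(** The elements that pass through the tensor form a subalgebra, and the
    generators are among them. *)
Lemma par_sym_sep_idem : [pchar K] =i pred0 ->
  sym_sep_idem (sep_left u) (sep_right u).
Proof.
move=> char0; split=> [|V F bF|V F a]; first exact: sum_sep_mul.
  exact: sep_symmetric.
elim/par_algebra_ind: a V F => [g||c x y IHx IHy|x y IHx IHy] V F bF.
- exact: sep_comm_gen.
- by apply: eq_bigr => i _; rewrite mul1r mulr1.
- have [Fl Fr] := bF.
  under eq_bigr do rewrite mulrDl -scalerAl Fl.
  under [RHS]eq_bigr do rewrite mulrDr -scalerAr Fr.
  by rewrite !big_split /= -!scaler_sumr IHx // IHy.
under eq_bigr do rewrite -mulrA.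
have bG := bilin_comp (@linear_mull _ _ x) (@linear_id _ _) bF.
have /= -> := IHy _ _ bG.
have bH := bilin_comp (@linear_id _ _) (@linear_mulr _ _ y) bF.
have /= -> := IHx _ _ bH.
by apply: eq_bigr => i _; rewrite mulrA.
Qed.

Definition in_span (A : {set gT}) (x : R) :=
  exists c : gT -> K, x = \sum_(k in A) c k *: (P A * u k).

Lemma in_span_lin A c x y : in_span A x -> in_span A y -> in_span A (c *: x + y).
Proof.
move=> [d ->] [e ->]; exists (fun k => c * d k + e k).
rewrite scaler_sumr -big_split /=; apply: eq_bigr => k _.
by rewrite scalerA scalerDl.
Qed.

Lemma in_span0 A : in_span A 0.
Proof. by exists (fun=> 0); rewrite big1 // => k _; rewrite scale0r. Qed.

Lemma in_span_gen A g : in_span A (P A * u g).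
Proof.
have [gA|gA] := boolP (g \in A); last by rewrite par_proj_gen //; apply: in_span0.
exists (fun k => (k == g)%:R); rewrite (bigD1 g) //= eqxx scale1r big1 ?addr0 //.
by move=> k /andP[_ /negbTE->]; rewrite scale0r.
Qed.

Lemma in_span_sum A (I : finType) (J : {set I}) (c : I -> K) (x : I -> R) :
  (forall i, in_span A (x i)) -> in_span A (\sum_(i in J) c i *: x i).
Proof.
move=> Sx; apply: (big_ind (in_span A)) => [|y z Sy Sz|i _]; first exact: in_span0.
  by rewrite -[y]scale1r; apply: in_span_lin.
by rewrite -[_ *: _]addr0; apply: in_span_lin (in_span0 A).
Qed.

(** The arrows with target A span the right ideal of P A. *)
Lemma par_proj_span A x : in_span A (P A * x).
Proof.
elim/par_algebra_ind: x A => [g||c x y Sx Sy|x y Sx Sy] A.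
- exact: in_span_gen.
- have [u1 _ _] := uP; rewrite -u1; exact: in_span_gen.
- by rewrite mulrDr -scalerAr; apply: in_span_lin.
have [c Ec] := Sx A; rewrite mulrA Ec mulr_suml.
under eq_bigr do rewrite -scalerAl; apply: in_span_sum => k.
have [d Ed] := Sy (k^-1 *: A)%g.
rewrite par_proj_mulC // -mulrA Ed mulr_sumr.
under eq_bigr do rewrite -scalerAr; apply: in_span_sum => l.
rewrite mulrA -par_proj_mulC // par_proj_genM //.
by case: ifP => _; [apply: in_span_gen | apply: in_span0].
Qed.

End PartialAlgebra.

(** * Independence of the groupoid basis *)

Section Translation.
Variables (K : fieldType) (gT : finGroupType) (N : nat) (r : 'I_N.+1 -> gT).
Hypothesis r_inj : injective r.

(** The partial action of G on a subset enumerated by r, restricting right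
    translation, as matrices acting on row vectors. *)
Definition trans_mx (h : gT) : 'M[K]_N.+1 := \matrix_(i, j) (r j == r i * h)%g%:R.
Local Notation rho := trans_mx.

Lemma trans_mxM h X i j k : r k = (r i * h)%g -> (rho h * X) i j = X k j.
Proof.
move=> rk; rewrite -mulmxE mxE (bigD1 k) //= mxE rk eqxx mul1r big1 ?addr0 //.
by move=> l lk; rewrite mxE -rk (inj_eq r_inj) (negbTE lk) mul0r.
Qed.

Lemma trans_mxM0 h X i j : (forall k, r k != (r i * h)%g) -> (rho h * X) i j = 0.
Proof.
move=> rih; rewrite -mulmxE mxE big1 // => k _.
by rewrite mxE (negbTE (rih k)) mul0r.
Qed.

Lemma trans_mx_cases i h :
  (exists k, r k = (r i * h)%g) \/ (forall k, r k != (r i * h)%g).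
Proof.
have [/existsP[k /eqP rk]|/existsPn nr] := boolP [exists k, r k == (r i * h)%g].
  by left; exists k.
by right.
Qed.

Lemma trans_mx_relations : par_relations rho.
Proof.
split=> [|s t|s t]; apply/matrixP=> i j.
- by rewrite !mxE mulg1 (inj_eq r_inj) eq_sym.
- rewrite -mulrA; have [[k rk]|nr] := trans_mx_cases i s^-1%g; last first.
    by rewrite !trans_mxM0.
  have ri : r i = (r k * s)%g by rewrite rk mulgKV.
  by rewrite !(trans_mxM _ _ rk) (trans_mxM _ _ ri) !mxE ri mulgA.
rewrite -mulrA; have [[k rk]|nr] := trans_mx_cases i s.
  rewrite (trans_mxM _ _ rk); have [[l rl]|nr] := trans_mx_cases k t.
    by rewrite (trans_mxM _ _ rl) (@trans_mxM _ _ _ _ l) // rl rk mulgA.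
  by rewrite !trans_mxM0 // => l; rewrite mulgA -rk.
rewrite trans_mxM0 //; have [[l rl]|nr'] := trans_mx_cases i (s * t)%g.
  by rewrite (trans_mxM _ _ rl) mxE rl mulgA mulgK (negbTE (nr j)).
by rewrite trans_mxM0.
Qed.

Lemma delta_mulE i0 (X : 'M[K]_N.+1) i j : (delta_mx i0 i0 * X) i j = (i == i0)%:R * X i0 j.
Proof.
rewrite -mulmxE mxE (bigD1 i0) //= mxE eqxx andbT big1 ?addr0 // => k k0.
by rewrite mxE (negbTE k0) andbF mul0r.
Qed.

(** The basis vector of 1 is a joint eigenvector of the e g, and e g acts on it
    by the indicator of the chosen subset; so only the projection of that
    subset sees it. *)
Lemma delta_trans_proj i0 (A B : {set gT}) : r i0 = 1%g -> (forall g, (g \in A) = (g \in codom r)) ->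
  delta_mx i0 i0 * par_proj rho B = if A == B then delta_mx i0 i0 else 0.
Proof.
move=> r0 Ar.
have Xe g : delta_mx i0 i0 * par_idem rho g = if g \in A then delta_mx i0 i0 else 0.
  apply/matrixP=> i j; rewrite delta_mulE Ar; case: ifPn => [/codomP[k rk]|nr].
    rewrite (@trans_mxM _ _ _ _ k) ?r0 ?mul1g // !mxE -rk mulgV -r0 (inj_eq r_inj).
    by rewrite -natrM mulnb.
  rewrite trans_mxM0 ?mxE ?mulr0 // => k; rewrite r0 mul1g.
  by apply: contraNneq nr => <-; apply: codom_f.
have X0 C : A != C -> delta_mx i0 i0 * par_proj rho C = 0.
  by move=> neqAC; apply: (par_proj_uniq trans_mx_relations neqAC Xe).
case: eqP => [<-|/eqP/X0 //].
rewrite -[RHS]mulr1 -(sum_par_proj trans_mx) mulr_sumr (bigD1 A) //= big1 ?addr0 //.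
by move=> C; rewrite eq_sym => /X0.
Qed.

End Translation.

Lemma par_proj_morph (K : fieldType) (gT : finGroupType) (R S : algType K)
    (f : {lrmorphism R -> S}) (u : gT -> R) A :
  f (par_proj u A) = par_proj (f \o u) A.
Proof.
rewrite rmorph_prod; apply: eq_bigr => g _; rewrite /par_factor.
by case: ifP; rewrite ?rmorphB ?rmorph1 /= rmorphM.
Qed.

Section Freeness.
Variables (K : fieldType) (gT : finGroupType).
Local Notation u := (@par_gen K gT).
Local Notation P := (par_proj u).

Definition par_basis (p : {set gT} * gT) : par_algebra K gT := P p.1 * u p.2.

(** To isolate the coefficient at (A, g), let the algebra act on the subset A
    by restricted translations and look at the image of the basis vector of 1:
    the element P B * u h kills it unless B = A, and sends it to the basis
    vector of h if B = A. *)
Lemma par_basis_free (S : {set {set gT} * gT}) (c : {set gT} * gT -> K) :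
    {in S, forall p : {set gT} * gT, (1%g \in p.1) && (p.2 \in p.1)} ->
    \sum_(p in S) c p *: par_basis p = 0 ->
  {in S, forall p : {set gT} * gT, c p = 0}.
Proof.
move=> S1 sum0 [A g] SAg; have /andP[/= A1 Ag] := S1 _ SAg.
have [N cA] : exists N, #|A| = N.+1.
  by exists #|A|.-1; rewrite prednK //; apply/card_gt0P; exists 1%g.
pose r (i : 'I_N.+1) := nth 1%g (enum A) i.
have r_inj : injective r.
  move=> i j /eqP; rewrite nth_uniq ?enum_uniq -?cardE ?cA ?ltn_ord // => /eqP.
  exact: val_inj.
have Ar h : (h \in A) = (h \in codom r).
  rewrite -mem_enum; apply/idP/codomP => [hA|[i ->]]; last first.
    by rewrite mem_nth // -cardE cA.
  have lt : (index h (enum A) < N.+1)%N by rewrite -cA cardE index_mem.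
  by exists (Ordinal lt); rewrite /r nth_index.
have /codomP[i0 /esym r0] : 1%g \in codom r by rewrite -Ar.
have /codomP[j rj] : g \in codom r by rewrite -Ar.
have [f [fu _]] := par_universal (trans_mx_relations K r_inj).
have fP B : f (P B) = par_proj (trans_mx K r) B.
  rewrite par_proj_morph; apply: eq_bigr => h _.
  by rewrite /par_factor /par_idem /= !fu.
have := congr1 (fun x => (delta_mx i0 i0 * f x) i0 j) sum0 => /=.
rewrite rmorph0 mulr0 [RHS]mxE linear_sum mulr_sumr summxE (bigD1 (A, g)) //= big1 ?addr0.
  rewrite linearZ_LR /= -scalerAr mxE rmorphM /= fP fu mulrA.
  rewrite (@delta_trans_proj K gT N r r_inj i0 A _ r0 Ar) eqxx delta_mulE mxE r0 rj mul1g !eqxx.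
  by rewrite !mulr1.
move=> [B h] /andP[SBh neq]; rewrite linearZ_LR /= -scalerAr mxE rmorphM /= fP fu mulrA.
rewrite (@delta_trans_proj K gT N r r_inj i0 A _ r0 Ar); case: (A =P B) neq => [<-|] neq; last first.
  by rewrite mul0r mxE mulr0.
rewrite delta_mulE mxE r0 -rj mul1g; case: (g =P h) => [E|]; last by rewrite !mulr0.
by case/eqP: neq; rewrite E.
Qed.

End Freeness.

(** * The eigenspaces of the Casimir element *)

Lemma natr_inj_pchar0 (K : fieldType) : [pchar K] =i pred0 ->
  injective (fun n : nat => n%:R : K).
Proof.
move=> /pcharf0P char0 m n.
suff le a b : (a <= b)%N -> a%:R = b%:R :> K -> a = b.
  by case/orP: (leq_total m n) => [/le//|/le h /esym/h].
move=> le E; apply/eqP; rewrite eqn_leq le -subn_eq0 -char0 natrB //.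
by rewrite E subrr eqxx.
Qed.

Section Eigenspace.
Variables (K : fieldType) (gT : finGroupType).
Hypothesis char0 : [pchar K] =i pred0.
Hypothesis abelG : abelian [set: gT].
Local Notation u := (@par_gen K gT).
Local Notation P := (par_proj u).
Let uP := par_gen_relations K gT.

Definition par_casimir : par_algebra K gT := casimir (sep_left u) (sep_right u).

Definition basis_index m : {set {set gT} * gT} :=
  [set p : {set gT} * gT | ((1%g \in p.1) && (#|p.1| == m * #|stab p.1|)%N) && (p.2 \in p.1)].

Lemma card_basis_index m : #|basis_index m| = pointed_sets_weight gT m.
Proof.
rewrite -sum1dep_card /pointed_sets_weight.
under [RHS]eq_bigr do rewrite -sum1_card.
by rewrite pair_big_dep.
Qed.

(** The eigenvalue (|stab A| / |A|)^2 is compared with 1 / m^2 in the prime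
    field, where characteristic zero turns equality of squares into equality of
    natural numbers. *)
Lemma casimir_eigenval_eq1 m (A : {set gT}) : 1%g \in A ->
  (m%:R ^+ 2 * casimir_eigenval K A == 1) = (#|A| == m * #|stab A|)%N.
Proof.
move=> A1; have cA0 : #|A|%:R != 0 :> K.
  rewrite -[0]/(0%:R) (inj_eq (natr_inj_pchar0 char0)) -lt0n; apply/card_gt0P.
  by exists 1%g.
rewrite /casimir_eigenval -exprMn mulrA expr_div_n -natrM.
rewrite -(inj_eq (mulIf (expf_neq0 2 cA0))) mulfVK ?expf_neq0 // mul1r -!natrX.
by rewrite (inj_eq (natr_inj_pchar0 char0)) eqn_sqr eq_sym.
Qed.

Lemma par_proj_casimir A : P A * par_casimir = casimir_eigenval K A *: P A.
Proof.
rewrite /par_casimir par_casimirE // mulr_sumr (bigD1 A) //= big1 ?addr0.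
  by rewrite -scalerAr par_projM // eqxx.
by move=> B; rewrite eq_sym => /negbTE BA; rewrite -scalerAr par_projM // BA scaler0.
Qed.

Lemma par_casimir_proj A : par_casimir * P A = casimir_eigenval K A *: P A.
Proof.
rewrite /par_casimir par_casimirE // mulr_suml (bigD1 A) //= big1 ?addr0.
  by rewrite -scalerAl par_projM // eqxx.
by move=> B /negbTE BA; rewrite -scalerAl par_projM // BA scaler0.
Qed.

Lemma basis_index_eigen m : {in basis_index m, forall p : {set gT} * gT,
  m%:R ^+ 2 *: (par_casimir * par_basis K p) = par_basis K p}.
Proof.
move=> [A k]; rewrite inE /= => /andP[/andP[A1 cA] _].
rewrite /par_basis mulrA par_casimir_proj -scalerAl scalerA.
by move: cA; rewrite -casimir_eigenval_eq1 // => /eqP ->; rewrite scale1r.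
Qed.

(** The component P A * a of an eigenvector vanishes unless A has the right
    eigenvalue, and every component is spanned by arrows. *)
Lemma eigen_span m a : m%:R ^+ 2 *: (par_casimir * a) = a ->
  exists d : {set gT} * gT -> K, a = \sum_(p in basis_index m) d p *: par_basis K p.
Proof.
move=> za.
have Pa (A : {set gT}) : ~~ ((1%g \in A) && (#|A| == m * #|stab A|)%N) -> P A * a = 0.
  have [A1|A1 _] := boolP (1%g \in A); last by rewrite par_proj_unit0 // mul0r.
  rewrite -casimir_eigenval_eq1 //= => w1.
  have E : P A * a = (m%:R ^+ 2 * casimir_eigenval K A) *: (P A * a).
    by rewrite -{1}za -scalerAr mulrA par_proj_casimir -scalerAl scalerA.
  have : (1 - m%:R ^+ 2 * casimir_eigenval K A) *: (P A * a) = 0.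
    by rewrite scalerBl scale1r -E subrr.
  by move/eqP; rewrite scaler_eq0 subr_eq0 eq_sym (negbTE w1) => /eqP.
have [d dE] : exists d : {set gT} -> gT -> K,
    forall A, P A * a = \sum_(k in A) d A k *: (P A * u k).
  apply: (@fin_all_exists _ (fun=> gT -> K)
    (fun A dA => P A * a = \sum_(k in A) dA k *: (P A * u k))) => A.
  exact: par_proj_span.
exists (fun p => d p.1 p.2).
rewrite -[LHS]mul1r -(sum_par_proj u) mulr_suml (bigID (fun A : {set gT} =>
  (1%g \in A) && (#|A| == m * #|stab A|)%N)) /= [X in _ + X]big1 ?addr0 //.
under eq_bigr do rewrite dE.
rewrite pair_big_dep; apply: eq_bigl => -[A k] /=.
by rewrite inE.
Qed.

End Eigenspace.

(** An isomorphism respects the Casimir elements, so it embeds the eigenspaces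
    of one into those of the other, and the weights are their dimensions. *)
Lemma weight_leq (K : fieldType) (gT hT : finGroupType)
    (f : {lrmorphism par_algebra K gT -> par_algebra K hT}) m :
    [pchar K] =i pred0 -> abelian [set: gT] -> abelian [set: hT] ->
    bijective f ->
  (pointed_sets_weight gT m <= pointed_sets_weight hT m)%N.
Proof.
move=> char0 abelG abelH f_bij.
have fz : f (par_casimir K gT) = par_casimir K hT.
  rewrite casimir_morph; apply: casimir_uniq (par_sym_sep_idem hT char0).
  exact: sym_sep_idem_morph (par_sym_sep_idem gT char0).
rewrite -!card_basis_index.
apply: (@free_span_leq K (par_algebra K hT) _ _ (basis_index gT m) (basis_index hT m)
  (fun p => f (@par_basis K gT p)) (@par_basis K hT)).
  move=> c sum0; apply: par_basis_free => [p|].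
    by rewrite inE => /andP[/andP[-> _] ->].
  apply: (bij_inj f_bij); rewrite rmorph0 linear_sum /= -[RHS]sum0.
  by apply: eq_bigr => p _; rewrite linearZ_LR.
move=> p Sp; apply: eigen_span => //.
by rewrite -fz -rmorphM -linearZ_LR /= basis_index_eigen.
Qed.

Lemma alg_isomorphic_sym (K : fieldType) (A B : algType K) :
  alg_isomorphic A B -> alg_isomorphic B A.
Proof.
case=> f [g fK gK].
have g_lin : linear g by apply: (can2_linear fK gK).
have g_mon : monoid_morphism g by apply: (can2_monoid_morphism fK gK).
pose gL := GRing.isLinear.Build K B A _ g g_lin.
pose gM := GRing.isMonoidMorphism.Build B A g g_mon.
pose G : {lrmorphism B -> A} := HB.pack g gL gM.
by exists G; exists f.
Qed.

(** Each A with 1 in A occurs for exactly one m, as |stab A| divides |A|. *)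
Lemma sum_pointed_sets_weight (gT : finGroupType) M :
    abelian [set: gT] -> (#|gT| < M)%N ->
  (\sum_(m < M) pointed_sets_weight gT m = \sum_(A : {set gT} | 1%g \in A) #|A|)%N.
Proof.
move=> abelG ltM.
have lt (A : {set gT}) : (#|A| %/ #|stab A| < M)%N.
  by apply: leq_ltn_trans (leq_div _ _) (leq_ltn_trans (max_card _) ltM).
rewrite [RHS](partition_big (fun A => Ordinal (lt A)) predT) //=.
apply: eq_bigr => m _; apply: eq_bigl => A; rewrite -val_eqE /=.
have S0 : (0 < #|stab A|)%N by apply: (cardG_gt0 (stab_group A)).
by rewrite [X in _ = _ && X]eq_sym eqn_div ?dvdn_card_stab // [in RHS]eq_sym.
Qed.

(** The total weight is (n + 1) 2^(n - 1) / 2 for a group of order n, a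
    strictly increasing function of n. *)
Lemma eq_card_pointed_sets_weight (gT hT : finGroupType) :
    abelian [set: gT] -> abelian [set: hT] ->
    (forall m, pointed_sets_weight gT m = pointed_sets_weight hT m) ->
  #|gT| = #|hT|.
Proof.
move=> abelG abelH eqw.
have : (#|gT|.+1 * 2 ^ #|gT|.-1 = #|hT|.+1 * 2 ^ #|hT|.-1)%N.
  rewrite -(sum_card_pointed (1%g : gT)) -(sum_card_pointed (1%g : hT)).
  pose M := (maxn #|gT| #|hT|).+1.
  rewrite -(@sum_pointed_sets_weight gT M) ?ltnS ?leq_maxl //.
  rewrite -(@sum_pointed_sets_weight hT M) ?ltnS ?leq_maxr //.
  by congr (_ * _)%N; apply: eq_bigr => m _; apply: eqw.
have mono a b : (a < b)%N -> (a.+1 * 2 ^ a.-1 < b.+1 * 2 ^ b.-1)%N.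
  move=> ab; apply: leq_trans (_ : b.+1 * 2 ^ a.-1 <= _)%N.
    by rewrite ltn_pmul2r ?expn_gt0.
  by rewrite leq_pmul2l // leq_exp2l //; lia.
by case: (ltngtP #|gT| #|hT|) => // /mono + E; rewrite E ltnn.
Qed.

Theorem theorem4p4 (gT hT : finGroupType) (K : fieldType)
    (abelG : abelian [set: gT]) (abelH : abelian [set: hT])
    (charK : [pchar K]%R =i pred0)
    (isoGH : alg_isomorphic (par_algebra K gT) (par_algebra K hT)) :
  [set: gT] \isog [set: hT].
Proof.
have eqw m : pointed_sets_weight gT m = pointed_sets_weight hT m.
  apply/eqP; rewrite eqn_leq; apply/andP; split.
    by case: isoGH => f; apply: weight_leq.
  by case: (alg_isomorphic_sym isoGH) => f; apply: weight_leq.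
exact: isog_pointed_sets_weight (eq_card_pointed_sets_weight abelG abelH eqw) eqw.
Qed.
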